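(* Let $\vec B\in C^3(\mathbb{R}^2,\mathbb{R}^2)$ satisfy the standing sign conditions listed in the context, let $\alpha\in(0,d/2)$, and let $D_\alpha$ and $F$ be as in the context. For $f\in C^2(D_\alpha)$ and $P,Q\in C^2((0,\alpha))$ let $u_{f,P,Q}\in C^2(D_\alpha)$ be the unique solution of $$\left\{\begin{array}{ll} -\Delta_\parallel u=f & \text{in } D_\alpha,\\ u(x_0,L/2)=P(x_0) & \text{for all } x_0\in(0,\alpha),\\ \langle\nabla u,\vec b\rangle(x_0,L/2)=\partial_y u(x_0,L/2)=Q(x_0) & \text{for all } x_0\in(0,\alpha). \end{array}\right.$$ Then for every $\delta\in(0,\alpha/2)$ there exists a constant $C(\alpha,\delta,\vec b)$, depending only on $\alpha$, $\delta$ and $\vec b$, such that for all $f,f_0\in C^2(D_\alpha)$ and all $P,P_0,Q,Q_0\in C^2((0,\alpha))$, $$\|u_{f,P,Q}-u_{f_0,P_0,Q_0}\|_{C^2(D_\alpha^\delta)}\le C(\alpha,\delta,\vec b)\Big(\|f-f_0\|_{C^2(D_\alpha^\delta)}+\|P-P_0\|_{C^2(\delta,\alpha-\delta)}+\|Q-Q_0\|_{C^2(\delta,\alpha-\delta)}\Big),$$ where $D_\alpha^\delta:=F\big((\delta,\alpha-\delta)\times(-\delta^{-1},\delta^{-1})\big)$.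
   Context: Standing conditions on $\vec B=(B_x,B_y)$: there are constants $\varepsilon,d,L>0$ such that, with $S:=(d/2,L/2)$, for $(x,y)\in(-\varepsilon,d+\varepsilon)\times\mathbb{R}$ one has $\vec B(x,y)=\vec 0$ if and only if $(x,y)=S$, and moreover: $B_x>0$ in $(0,d)\times(-\infty,L/2)$ and $B_x<0$ in $(0,d)\times(L/2,+\infty)$; $B_x<0$ in $(-\varepsilon,0)\times(-\infty,L/2)$ and $B_x>0$ in $(-\varepsilon,0)\times(L/2,+\infty)$; $B_y>0$ in $(-\varepsilon,d/2)\times\mathbb{R}$ and $B_y<0$ in $(d/2,d+\varepsilon)\times\mathbb{R}$; $B_x(0,y)=B_x(d,y)=0$ for all $y\in\mathbb{R}$; $B_y(x,L)>0$ and $B_y(x,0)>0$ for $0\le x<d/2$. The normalized field is $\vec b:=\vec B/\|\vec B\|$ on $((-\varepsilon,d+\varepsilon)\times\mathbb{R})\setminus\{S\}$ (Euclidean norm). The flow $t\mapsto\Phi_t(p)$ is the solution of $\frac{d}{dt}\Phi_t(p)=\vec b(\Phi_t(p))$, $\Phi_0(p)=p$; trajectories starting at $(x_0,L/2)$ with $-\varepsilon/2<x_0<d/2$ are defined for all $t\in\mathbb{R}$. For $\alpha\in(0,d/2)$ write $(x_\alpha(t),y_\alpha(t)):=\Phi_t(\alpha,L/2)$, $t\in\mathbb{R}$; $y_\alpha$ is a $C^1$-diffeomorphism from $\mathbb{R}$ onto an open interval $I\supset[0,L]$. Define $D_\alpha:=\{(x,y)\in(0,d/2)\times I:\ 0<x<x_\alpha(y_\alpha^{-1}(y))\}$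 and $F:(0,\alpha)\times\mathbb{R}\to D_\alpha$, $F(x_0,t):=\Phi_t(x_0,L/2)$, which is a $C^1$-diffeomorphism. $\Delta_\parallel u:=\nabla\cdot\big((\vec b\otimes\vec b)\nabla u\big)$. For an open set $U$, $\|\cdot\|_{C^2(U)}$ is the sup over $U$ of the function and its derivatives up to order 2 (possibly $+\infty$ for a general $C^2$ function on an open set). Existence and uniqueness of $u_{f,P,Q}$ is a separate result of the paper. *)

(* Defs.v *)
(* Classical reals of the standard library, with Coquelicot's total
   derivatives and extended reals. *)
From Stdlib Require Import Reals.
From Coquelicot Require Import Coquelicot.
Open Scope R_scope.

Definition xcomp (V : R * R -> R * R) (x y : R) : R := fst (V (x, y)).
Definition ycomp (V : R * R -> R * R) (x y : R) : R := snd (V (x, y)).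

(* Functions on an open subset of the plane or of the line are represented by
   total functions.  All notions below only involve values at, and derivatives
   at, points of the open set, so they do not depend on the extension. *)

Definition Cn_plane (n : nat) (U : R -> R -> Prop) (f : R -> R -> R) : Prop :=
  forall x y, U x y -> ex_diff_n f n x y.

Definition Cn_line (n : nat) (U : R -> Prop) (f : R -> R) : Prop :=
  forall k x, (k <= n)%nat -> U x ->
    ex_derive_n f k x /\ continuous (Derive_n f k) x.

(* Possibly infinite C^n norms: suprema of the absolute values of all partial
   derivatives of order at most n. *)
Definition norm_plane (n : nat) (U : R -> R -> Prop) (f : R -> R -> R) : Rbar :=
  Lub_Rbar (fun r => exists j k x y,
    (j + k <= n)%nat /\ U x y /\ r = Rabs (partial_derive j k f x y)).

Definition norm_line (n : nat) (U : R -> Prop) (f : R -> R) : Rbar :=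
  Lub_Rbar (fun r => exists k x,
    (k <= n)%nat /\ U x /\ r = Rabs (Derive_n f k x)).

Definition strip (eps d x : R) : Prop := - eps < x < d + eps.

Definition field_domain (eps d L : R) (p : R * R) : Prop :=
  strip eps d (fst p) /\ p <> (d / 2, L / 2).

Record standing (eps d L : R) (B : R * R -> R * R) : Prop := {
  eps_pos : 0 < eps;
  d_pos : 0 < d;
  L_pos : 0 < L;
  B_zero : forall x y, strip eps d x ->
    (B (x, y) = (0, 0) <-> (x, y) = (d / 2, L / 2));
  Bx_in_below : forall x y, 0 < x < d -> y < L / 2 -> 0 < xcomp B x y;
  Bx_in_above : forall x y, 0 < x < d -> L / 2 < y -> xcomp B x y < 0;
  Bx_out_below : forall x y, - eps < x < 0 -> y < L / 2 -> xcomp B x y < 0;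
  Bx_out_above : forall x y, - eps < x < 0 -> L / 2 < y -> 0 < xcomp B x y;
  By_left : forall x y, - eps < x < d / 2 -> 0 < ycomp B x y;
  By_right : forall x y, d / 2 < x < d + eps -> ycomp B x y < 0;
  Bx_walls : forall y, xcomp B 0 y = 0 /\ xcomp B d y = 0;
  By_ends : forall x, 0 <= x < d / 2 -> 0 < ycomp B x L /\ 0 < ycomp B x 0
}.

(* b is the normalization of B on [field_domain eps d L]; its values elsewhere
   are irrelevant. *)
Definition is_normalization (eps d L : R) (B b : R * R -> R * R) : Prop :=
  forall p, field_domain eps d L p ->
    let n := sqrt (fst (B p) ^ 2 + snd (B p) ^ 2) in
    b p = (fst (B p) / n, snd (B p) / n).

Definition is_trajectory (eps d L : R) (b : R * R -> R * R)
    (p : R * R) (g : R -> R * R) : Prop :=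
  g 0 = p /\
  forall t, field_domain eps d L (g t) /\
    is_derive (fun s => fst (g s)) t (fst (b (g t))) /\
    is_derive (fun s => snd (g s)) t (snd (b (g t))).

(* [Phi t p] is the flow of b, needed only for the starting points
   p = (x0, L/2) whose trajectories are defined for all times. *)
Definition is_flow (eps d L : R) (b : R * R -> R * R)
    (Phi : R -> R * R -> R * R) : Prop :=
  forall x0, - eps / 2 < x0 < d / 2 ->
    is_trajectory eps d L b (x0, L / 2) (fun t => Phi t (x0, L / 2)).

Definition flow_map (L : R) (Phi : R -> R * R -> R * R) (x0 t : R) : R * R :=
  Phi t (x0, L / 2).

(* Here t is the preimage of y under y_alpha : t |-> snd (flow_map alpha t),
   so its existence says that y lies in the range I of y_alpha, and the last
   bound is 0 < x < x_alpha (y_alpha^-1 y). *)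
Definition Dalpha (d L : R) (Phi : R -> R * R -> R * R) (alpha x y : R) : Prop :=
  0 < x < d / 2 /\
  exists t, snd (flow_map L Phi alpha t) = y /\
    0 < x < fst (flow_map L Phi alpha t).

Definition Ddelta (L : R) (Phi : R -> R * R -> R * R)
    (alpha delta x y : R) : Prop :=
  exists x0 t, delta < x0 < alpha - delta /\ - / delta < t < / delta /\
    flow_map L Phi x0 t = (x, y).

Definition dx (u : R -> R -> R) (x y : R) : R := Derive (fun z => u z y) x.
Definition dy (u : R -> R -> R) (x y : R) : R := Derive (fun z => u x z) y.

Definition Delta_par (b : R * R -> R * R) (u : R -> R -> R) (x y : R) : R :=
  let b1 := xcomp b in
  let b2 := ycomp b in
  dx (fun x y => b1 x y * b1 x y * dx u x y + b1 x y * b2 x y * dy u x y) x y +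
  dy (fun x y => b2 x y * b1 x y * dx u x y + b2 x y * b2 x y * dy u x y) x y.

Record is_solution (d L : R) (b : R * R -> R * R) (Phi : R -> R * R -> R * R)
    (alpha : R) (f : R -> R -> R) (P Q : R -> R) (u : R -> R -> R) : Prop := {
  sol_C2 : Cn_plane 2 (Dalpha d L Phi alpha) u;
  sol_eq : forall x y, Dalpha d L Phi alpha x y -> - Delta_par b u x y = f x y;
  sol_P : forall x0, 0 < x0 < alpha -> u x0 (L / 2) = P x0;
  sol_Q : forall x0, 0 < x0 < alpha ->
    dx u x0 (L / 2) * xcomp b x0 (L / 2) + dy u x0 (L / 2) * ycomp b x0 (L / 2)
      = dy u x0 (L / 2) /\
    dy u x0 (L / 2) = Q x0
}.

(* Main.v *)
Require Import Defs.
From Stdlib Require Import Reals Ranalysis5 Lra Lia.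
From Stdlib Require Import Classical ClassicalEpsilon FunctionalExtensionality.
From Coquelicot Require Import Coquelicot.
Open Scope R_scope.

(* Left of S the component B_y is positive, so every trajectory is a graph over
   the y-axis: x = X(x0,y) with dX/dy = h(X,y), h = B_x/B_y.  This equation is
   scalar, hence J = dX/dx0 equals exp(int h_x(X,s) ds) and inherits its
   regularity and its bounds from h_x by bootstrapping.
   With k = b_y^2 and m = k (h u_x + u_y) one has Delta_par u = (h m)_x + m_y, so
   along a trajectory (m J)_y = - f J and d/dy u(X,y) = m/k.  Integrating twice
   writes u(X,y) in terms of P, Q, f, and two x0-derivatives of this formula
   bound u_x, u_xx, m and m_x; the definition of m and the equation then give
   the remaining derivatives algebraically.  All constants come from suprema of
   h, k and their derivatives on [0,alpha] x [L/2 - 1/delta, L/2 + 1/delta],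
   a rectangle containing the trajectories for |t| < 1/delta since |b_y| <= 1. *)

(** * Functions with bounded x-derivatives *)

(** The flow map F is never inverted. In the coordinates (x0, y), unlike (x0, t), heights are
    unchanged: only the abscissa is transported, and every Jacobian is the scalar J. The right side
    of the estimate sees the data on D_alpha^delta alone, so bounds are tracked on the preimage of
    that set in (x0, y). This preimage contains the vertical segments back to height L/2, so
    integrals starting there use the available bounds only. Along trajectories x stays at most x0
    but may approach 0. The rectangle therefore includes x = 0, where h and k are still regular
    thanks to the margin eps. Derivative count: h_x costs one of the three derivatives of B, and the
    two that remain match the two x0-derivatives needed of J. Each step is linear in the data, with
    factors determined by h, k, alpha and delta. An infinite norm on the right makes the claim
    trivial because C > 0. *)

(* f has n derivatives in x, all jointly continuous on U and bounded by M on K;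
   keeping U and K apart lets regularity live on an open set while bounds are
   only tracked where the data are controlled.  K may be empty. *)
Fixpoint xsmooth (n : nat) (U K : R -> R -> Prop) (M : R) (f : R -> R -> R)
    : Prop :=
  (forall x y, U x y -> continuity_2d_pt f x y) /\
  (forall x y, K x y -> Rabs (f x y) <= M) /\
  match n with
  | O => True
  | S p => exists f' : R -> R -> R,
      (forall x y, U x y -> is_derive (fun z => f z y) x (f' x y)) /\
      xsmooth p U K M f'
  end.

Lemma xsmooth_cont n U K M f x y :
  xsmooth n U K M f -> U x y -> continuity_2d_pt f x y.
Proof. destruct n; intros H; apply H. Qed.

Lemma xsmooth_bound n U K M f x y :
  xsmooth n U K M f -> K x y -> Rabs (f x y) <= M.
Proof. destruct n; intros H; apply H. Qed.

Lemma xsmooth_le n U K M M' f :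
  M <= M' -> xsmooth n U K M f -> xsmooth n U K M' f.
Proof.
intros HM; revert f; induction n; simpl; intros f (Hc & Hb & H); repeat split; auto.
- intros x y Hk; specialize (Hb x y Hk); lra.
- intros x y Hk; specialize (Hb x y Hk); lra.
- destruct H as (f' & Hd & H); exists f'; auto.
Qed.

Lemma xsmooth_pred n U K M f : xsmooth (S n) U K M f -> xsmooth n U K M f.
Proof.
revert f; induction n; intros f (Hc & Hb & f' & Hd & H).
- now repeat split.
- split; [|split]; auto. exists f'; auto.
Qed.

Lemma xsmooth_sub n (U U' K K' : R -> R -> Prop) M f :
  (forall x y, U' x y -> U x y) -> (forall x y, K' x y -> K x y) ->
  xsmooth n U K M f -> xsmooth n U' K' M f.
Proof.
intros HU HK; revert f; induction n; simpl; intros f (Hc & Hb & H); repeat split; auto.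
destruct H as (f' & Hd & H); exists f'; auto.
Qed.

Lemma xsmooth_plus n U K M1 M2 f g :
  xsmooth n U K M1 f -> xsmooth n U K M2 g ->
  xsmooth n U K (M1 + M2) (fun x y => f x y + g x y).
Proof.
revert f g; induction n; simpl; intros f g (Hc & Hb & H) (Hc' & Hb' & H'); repeat split; auto.
- intros; apply continuity_2d_pt_plus; auto.
- intros; eapply Rle_trans; [apply Rabs_triang|]. specialize (Hb x y H0); specialize (Hb' x y H0); lra.
- intros; apply continuity_2d_pt_plus; auto.
- intros; eapply Rle_trans; [apply Rabs_triang|]. specialize (Hb x y H0); specialize (Hb' x y H0); lra.
- destruct H as (f' & Hd & H), H' as (g' & Hd' & H').
  exists (fun x y => f' x y + g' x y); split; auto.
  intros; apply (@is_derive_plus R_AbsRing R_NormedModule); auto.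
Qed.

Lemma xsmooth_opp n U K M f :
  xsmooth n U K M f -> xsmooth n U K M (fun x y => - f x y).
Proof.
revert f; induction n; simpl; intros f (Hc & Hb & H); repeat split; auto.
- intros; apply continuity_2d_pt_opp; auto.
- intros; rewrite Rabs_Ropp; auto.
- intros; apply continuity_2d_pt_opp; auto.
- intros; rewrite Rabs_Ropp; auto.
- destruct H as (f' & Hd & H).
  exists (fun x y => - f' x y); split; auto.
  intros; apply (@is_derive_opp R_AbsRing R_NormedModule); auto.
Qed.

Lemma is_derive_Rmult (f g : R -> R) x f' g' :
  is_derive f x f' -> is_derive g x g' ->
  is_derive (fun z => f z * g z) x (f' * g x + f x * g').
Proof.
intros Hf Hg; apply is_derive_Reals; apply is_derive_Reals in Hf; apply is_derive_Reals in Hg.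
now apply derivable_pt_lim_mult.
Qed.

(** Leibniz rule: each differentiation doubles the number of products to be bounded, hence the
    factor 2^n. *)
Lemma xsmooth_mult n U K M1 M2 f g :
  xsmooth n U K M1 f -> xsmooth n U K M2 g ->
  xsmooth n U K (2 ^ n * (M1 * M2)) (fun x y => f x y * g x y).
Proof.
revert f g; induction n; intros f g Hf Hg;
  assert (B : forall x y, K x y -> Rabs (f x y * g x y) <= M1 * M2) by
  (intros x y Hk; rewrite Rabs_mult; apply Rmult_le_compat; auto using Rabs_pos;
   eapply xsmooth_bound; eauto).
- split; [|split]; auto.
  + intros; apply continuity_2d_pt_mult; eapply xsmooth_cont; eauto.
  + simpl; intros; rewrite Rmult_1_l; auto.
- assert (H1 := xsmooth_pred _ _ _ _ _ Hf). assert (H2 := xsmooth_pred _ _ _ _ _ Hg).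
  split; [|split]; auto.
  + intros; apply continuity_2d_pt_mult; eapply xsmooth_cont; eauto.
  + intros x y Hk; specialize (B x y Hk).
    assert (0 <= M1 * M2) by (eapply Rle_trans; [apply Rabs_pos|apply B]).
    assert (1 <= 2 ^ S n) by (apply pow_R1_Rle; lra). nra.
  + destruct Hf as (_ & _ & f' & Hd & Hf), Hg as (_ & _ & g' & Hd' & Hg).
    exists (fun x y => f' x y * g x y + f x y * g' x y); split.
    * intros; apply (is_derive_Rmult (fun z => f z y) (fun z => g z y)); auto.
    * replace (2 ^ S n * (M1 * M2)) with (2 ^ n * (M1 * M2) + 2 ^ n * (M1 * M2)) by (simpl; ring).
      apply xsmooth_plus; auto.
Qed.

Lemma is_derive_Rcomp (f g : R -> R) x f' g' :
  is_derive f (g x) f' -> is_derive g x g' ->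
  is_derive (fun z => f (g z)) x (f' * g').
Proof.
intros Hf Hg. rewrite Rmult_comm. exact (is_derive_comp f g x f' g' Hf Hg).
Qed.

Lemma continuity_2d_pt_comp_x g X x y :
  continuity_2d_pt g (X x y) y -> continuity_2d_pt X x y ->
  continuity_2d_pt (fun u v => g (X u v) v) x y.
Proof.
intros Hg HX eps. destruct (Hg eps) as [d1 H1]. destruct (HX d1) as [d2 H2].
assert (Hm : 0 < Rmin d1 d2) by (apply Rmin_pos; apply cond_pos).
exists (mkposreal _ Hm); simpl; intros u v Hu Hv.
assert (Rmin d1 d2 <= d1) by apply Rmin_l. assert (Rmin d1 d2 <= d2) by apply Rmin_r.
apply H1; [apply H2|]; lra.
Qed.

(** The bound must be linear in [M], since [g] will be the source term and [M] the size of the data;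
    all dependence on the flow [X] is absorbed into [C], fixed by [n] and [MX]. *)
Lemma xsmooth_comp n MX : exists C, 0 <= C /\
  forall (U K V V' : R -> R -> Prop) M g X, 0 <= M ->
  xsmooth n V V' M g -> xsmooth n U K MX X ->
  (forall x y, U x y -> V (X x y) y) -> (forall x y, K x y -> V' (X x y) y) ->
  xsmooth n U K (C * M) (fun x y => g (X x y) y).
Proof.
induction n.
- exists 1; split; [lra|]. intros U K V V' M g X HM Hg HX HU HK; split; [|split]; auto.
  + intros; apply continuity_2d_pt_comp_x; eapply xsmooth_cont; eauto.
  + intros x y Hk; rewrite Rmult_1_l; eapply xsmooth_bound with (K := V'); eauto.
- destruct IHn as (C & HC & IH).
  assert (0 <= 2 ^ n * (C * Rabs MX)).
  { apply Rmult_le_pos; [apply pow_le; lra|]. apply Rmult_le_pos; auto using Rabs_pos. }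
  exists (1 + 2 ^ n * (C * Rabs MX)); split; [lra|].
  intros U K V V' M g X HM Hg HX HU HK; split; [|split].
  + intros; apply continuity_2d_pt_comp_x; eapply xsmooth_cont; eauto.
  + intros x y Hk.
    assert (Hb : Rabs (g (X x y) y) <= M) by (eapply xsmooth_bound with (K := V'); eauto). nra.
  + assert (HX' := xsmooth_pred _ _ _ _ _ HX).
    destruct Hg as (_ & _ & g' & Hd & Hg), HX as (_ & _ & X' & HdX & HX).
    exists (fun x y => g' (X x y) y * X' x y); split.
    * intros x y Hxy. apply (is_derive_Rcomp (fun z => g z y) (fun z => X z y)); auto.
    * apply xsmooth_le with (2 ^ n * ((C * M) * Rabs MX)); [nra|].
      apply xsmooth_mult; [eapply IH; eauto|].
      apply xsmooth_le with MX; auto. apply Rle_abs.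
Qed.

Lemma xsmooth_exp n M : exists M', forall U K f,
  xsmooth n U K M f -> xsmooth n U K M' (fun x y => exp (f x y)).
Proof.
assert (Hc : forall n U K f x y, xsmooth n U K M f -> U x y ->
   continuity_2d_pt (fun x y => exp (f x y)) x y).
{ intros; apply continuity_1d_2d_pt_comp; [|eapply xsmooth_cont; eauto].
  apply derivable_continuous_pt, derivable_pt_exp. }
assert (Hb : forall n U K f x y, xsmooth n U K M f -> K x y -> Rabs (exp (f x y)) <= exp M).
{ intros. rewrite Rabs_pos_eq by (left; apply exp_pos).
  assert (f x y <= M) by (eapply Rle_trans; [apply Rle_abs|]; eapply xsmooth_bound; eauto).
  destruct H1; [left; now apply exp_increasing|rewrite H1; lra]. }
induction n.
- exists (exp M); intros U K f Hf; split; [|split]; auto.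
  + intros; eapply Hc; eauto.
  + intros; eapply Hb; eauto.
- destruct IHn as (M' & IH). exists (Rmax (exp M) (2 ^ n * (M * M'))).
  intros U K f Hf; split; [|split].
  + intros; eapply Hc; eauto.
  + intros; eapply Rle_trans; [|apply Rmax_l]; eapply Hb; eauto.
  + assert (H' := xsmooth_pred _ _ _ _ _ Hf).
    destruct Hf as (_ & _ & f' & Hd & Hf). exists (fun x y => f' x y * exp (f x y)); split.
    * intros x y Hxy. rewrite Rmult_comm. apply (is_derive_Rcomp exp (fun z => f z y)); auto.
      apply is_derive_Reals, derivable_pt_lim_exp.
    * apply xsmooth_le with (1 := Rmax_r _ _). apply xsmooth_mult; auto.
Qed.

Lemma is_derive_Rinv (f : R -> R) x f' : is_derive f x f' -> f x <> 0 ->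
  is_derive (fun z => / f z) x (- (f' * (/ f x * / f x))).
Proof.
intros Hf Hn. replace (- (f' * (/ f x * / f x))) with (- f' / f x ^ 2) by (field; auto).
now apply is_derive_inv.
Qed.

Lemma xsmooth_inv n M c : exists M', forall (U K : R -> R -> Prop) f,
  xsmooth n U K M f -> (forall x y, U x y -> f x y <> 0) ->
  (forall x y, K x y -> Rabs (/ f x y) <= c) ->
  xsmooth n U K M' (fun x y => / f x y).
Proof.
induction n.
- exists c; intros U K f Hf Hn Hb; split; [|split]; auto.
  intros; apply continuity_2d_pt_inv; auto; eapply xsmooth_cont; eauto.
- destruct IHn as (M' & IH). exists (Rmax c (2 ^ n * (M * (2 ^ n * (M' * M'))))).
  intros U K f Hf Hn Hb; split; [|split].
  + intros; apply continuity_2d_pt_inv; auto; eapply xsmooth_cont; eauto.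
  + intros; eapply Rle_trans; [|apply Rmax_l]; auto.
  + assert (H' := xsmooth_pred _ _ _ _ _ Hf).
    destruct Hf as (_ & _ & f' & Hd & Hf).
    exists (fun x y => - (f' x y * (/ f x y * / f x y))); split.
    * intros x y Hxy. apply (is_derive_Rinv (fun z => f z y)); auto.
    * apply xsmooth_le with (1 := Rmax_r _ _). apply xsmooth_opp, xsmooth_mult; auto.
      apply xsmooth_mult; auto.
Qed.

(** * Integrals in y depending on the parameter x *)

Definition vstrip (a b x y : R) : Prop := a < x < b.

Lemma continuity_2d_pt_section_y f x y :
  continuity_2d_pt f x y -> continuous (f x) y.
Proof.
intros H. apply continuity_pt_filterlim. intros e He. destruct (H (mkposreal e He)) as [d Hd].
exists d; split; [apply cond_pos|]. intros z [_ Hz]; simpl in *; unfold R_dist in *.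
apply Hd; auto. rewrite Rminus_diag, Rabs_R0; apply cond_pos.
Qed.

Lemma ex_RInt_vstrip f a b x c y :
  (forall x y, vstrip a b x y -> continuity_2d_pt f x y) -> a < x < b ->
  ex_RInt (f x) c y.
Proof.
intros H Hx. apply (@ex_RInt_continuous R_CompleteNormedModule).
intros z _; apply continuity_2d_pt_section_y, H, Hx.
Qed.

Lemma locally_open_interval (a b x : R) : a < x < b -> locally x (fun z => a < z < b).
Proof.
intros [H1 H2]. apply filter_and; [exact (open_gt a x H1)|exact (open_lt b x H2)].
Qed.

Lemma vstrip_locally a b x y : vstrip a b x y -> locally_2d (vstrip a b) x y.
Proof.
intros H; destruct (locally_open_interval a b x H) as [d Hd].
exists d; intros u v Hu _; apply Hd, Hu.
Qed.

Lemma Rabs_RInt_le f c y M : ex_RInt f c y ->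
  (forall s, Rmin c y <= s <= Rmax c y -> Rabs (f s) <= M) ->
  Rabs (RInt f c y) <= Rabs (y - c) * M.
Proof.
intros He Hb. apply (norm_RInt_le_const_abs f c y _ M); auto.
now apply (@RInt_correct R_CompleteNormedModule).
Qed.

(** The increment splits in two: the change of integrand over the fixed segment from c to y, small
    by uniform continuity along that segment, and the integral from y to v, short and with integrand
    bounded near (x, y). *)
Lemma continuity_2d_pt_RInt f a b c x y :
  (forall x y, vstrip a b x y -> continuity_2d_pt f x y) -> a < x < b ->
  continuity_2d_pt (fun u v => RInt (f u) c v) x y.
Proof.
intros Hf Hx eps.
set (lo := Rmin c y). set (hi := Rmax c y).
(* The added 1 keeps the denominator positive when y = c. *)
set (e := eps / (2 * (hi - lo + 1))).
assert (Hlh : lo <= hi) by (unfold lo, hi; apply Rle_trans with c; [apply Rmin_l|apply Rmax_l]).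
assert (He : 0 < e).
{ unfold e; apply Rdiv_lt_0_compat; [apply cond_pos|lra]. }
destruct (uniform_continuity_2d_1d' f lo hi x (fun s _ => Hf x s Hx) (mkposreal e He)) as [d1 H1].
simpl in H1.
destruct (Hf x y Hx (mkposreal 1 Rlt_0_1)) as [d2 H2]; simpl in H2.
destruct (locally_open_interval a b x Hx) as [d3 H3].
set (M := Rabs (f x y) + 1).
assert (HM : 0 < M) by (unfold M; generalize (Rabs_pos (f x y)); lra).
assert (H4 : 0 < eps / (2 * M)) by (apply Rdiv_lt_0_compat; [apply cond_pos|lra]).
set (d := Rmin (Rmin d1 d2) (Rmin d3 (eps / (2 * M)))).
assert (Hd : 0 < d) by (unfold d; repeat apply Rmin_pos; try apply cond_pos; auto).
assert (D1 : d <= d1) by (unfold d; eapply Rle_trans; [apply Rmin_l|apply Rmin_l]).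
assert (D2 : d <= d2) by (unfold d; eapply Rle_trans; [apply Rmin_l|apply Rmin_r]).
assert (D3 : d <= d3) by (unfold d; eapply Rle_trans; [apply Rmin_r|apply Rmin_l]).
assert (D4 : d <= eps / (2 * M)) by (unfold d; eapply Rle_trans; [apply Rmin_r|apply Rmin_r]).
exists (mkposreal d Hd); simpl; intros u v Hu Hv.
assert (Hua : a < u < b) by (apply H3; apply Rlt_le_trans with d; auto).
assert (Iu : forall p q, ex_RInt (f u) p q) by (intros; eapply ex_RInt_vstrip; eauto).
assert (Ix : forall p q, ex_RInt (f x) p q) by (intros; eapply ex_RInt_vstrip; eauto).
replace (RInt (f u) c v - RInt (f x) c y) with
  (RInt (fun s => f u s - f x s) c y + RInt (f u) y v).
2:{ rewrite <- (RInt_Chasles (f u) c y v) by auto.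
    assert (E : RInt (fun s => f u s - f x s) c y = RInt (f u) c y - RInt (f x) c y)
      by (apply (RInt_minus (V := R_CompleteNormedModule)); auto).
    rewrite E. unfold plus; simpl; ring. }
assert (P1 : Rabs (RInt (fun s => f u s - f x s) c y) <= Rabs (y - c) * e).
{ apply Rabs_RInt_le.
  - apply (@ex_RInt_minus R_NormedModule); auto.
  - intros s Hs; left. apply H1; try (unfold lo, hi; tauto).
    + generalize (cond_pos d1); lra.
    + apply Rabs_def2 in Hu; lra.
    + rewrite Rminus_diag, Rabs_R0; apply cond_pos. }
assert (P2 : Rabs (RInt (f u) y v) <= Rabs (v - y) * M).
{ apply Rabs_RInt_le; auto.
  intros s Hs.
  assert (Hs' : Rabs (s - y) <= Rabs (v - y)).
  { revert Hs; unfold Rmin, Rmax; destruct (Rle_dec y v); intros;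
    [rewrite !Rabs_pos_eq by lra|rewrite !Rabs_left1 by lra]; lra. }
  assert (Q : Rabs (f u s - f x y) < 1) by (apply H2; lra).
  unfold M. replace (f u s) with (f x y + (f u s - f x y)) by ring.
  eapply Rle_trans; [apply Rabs_triang|]; lra. }
assert (Q1 : Rabs (y - c) * e <= eps / 2).
{ unfold e. assert (Rabs (y - c) = hi - lo).
  { unfold hi, lo, Rmin, Rmax; destruct (Rle_dec c y); [rewrite Rabs_pos_eq|rewrite Rabs_left1]; lra. }
  rewrite H. apply Rmult_le_reg_r with (2 * (hi - lo + 1)); [lra|].
  field_simplify; [|lra]. generalize (cond_pos eps); nra. }
assert (Q2 : Rabs (v - y) * M < eps / 2).
{ apply Rlt_le_trans with (eps / (2 * M) * M).
  - apply Rmult_lt_compat_r; auto; lra.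
  - right; field; lra. }
eapply Rle_lt_trans; [apply Rabs_triang|]; lra.
Qed.

Lemma is_derive_RInt_vstrip f f' a b c x y :
  (forall x y, vstrip a b x y -> continuity_2d_pt f x y) ->
  (forall x y, vstrip a b x y -> continuity_2d_pt f' x y) ->
  (forall x y, vstrip a b x y -> is_derive (fun z => f z y) x (f' x y)) ->
  a < x < b ->
  is_derive (fun z => RInt (f z) c y) x (RInt (f' x) c y).
Proof.
intros Hf Hf' Hd Hx.
replace (RInt (f' x) c y) with (RInt (fun t => Derive (fun z => f z t) x) c y).
2:{ apply RInt_ext; intros t _; apply is_derive_unique, Hd, Hx. }
apply (is_derive_RInt_param f c y x).
- generalize (locally_open_interval a b x Hx); apply filter_imp; intros z Hz t _.
  eexists; apply Hd, Hz.
- intros t _. apply continuity_2d_pt_ext_loc with f'; [|apply Hf', Hx].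
  destruct (vstrip_locally a b x t Hx) as [e He].
  exists e; intros u v Hu Hv; symmetry; apply is_derive_unique, Hd, (He u v Hu Hv).
- generalize (locally_open_interval a b x Hx); apply filter_imp; intros z Hz.
  eapply ex_RInt_vstrip; eauto.
Qed.

(* Vertical segments from height c stay in K, so integrals in y starting at c
   only see the bounds on K. *)
Definition vstar (c r : R) (K : R -> R -> Prop) : Prop :=
  forall x y, K x y -> Rabs (y - c) <= r /\
    forall s, Rmin c y <= s <= Rmax c y -> K x s.

(** Differentiation passes under the integral, so no order is lost; the factor r bounds the length
    of the segments. *)
Lemma xsmooth_RInt n a b K M f c r : vstar c r K ->
  (forall x y, K x y -> a < x < b) ->
  xsmooth n (vstrip a b) K M f ->
  xsmooth n (vstrip a b) K (r * M) (fun x y => RInt (f x) c y).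
Proof.
intros HK HKU; revert f; induction n; intros f Hf;
  assert (Hc : forall x y, vstrip a b x y -> continuity_2d_pt f x y)
    by (intros; eapply xsmooth_cont; eauto);
  (split; [|split]).
1, 4: intros; apply continuity_2d_pt_RInt with a b; auto.
1, 3: intros x y Hk; destruct (HK x y Hk) as [Hr Hs];
  apply Rle_trans with (Rabs (y - c) * M);
  [apply Rabs_RInt_le; [eapply ex_RInt_vstrip; eauto|];
   intros s Hs'; eapply xsmooth_bound; eauto
  |apply Rmult_le_compat_r; auto;
   eapply Rle_trans; [apply Rabs_pos|eapply xsmooth_bound; eauto]].
- auto.
- destruct Hf as (_ & _ & f' & Hd & Hf). exists (fun x y => RInt (f' x) c y); split; auto.
  intros x y Hx. apply is_derive_RInt_vstrip with a b; auto.
  intros; eapply xsmooth_cont; eauto.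
Qed.

(** Uniform continuity gives a step e over which f varies by less than 1. Walking from the corner
    (a, c) to (x, y) in n equal steps, with n large enough for all points of the rectangle at once,
    changes f by at most n. *)
Lemma bounded_on_rectangle f a b c d :
  (forall x y, a <= x <= b -> c <= y <= d -> continuity_2d_pt f x y) ->
  exists M, forall x y, a <= x <= b -> c <= y <= d -> Rabs (f x y) <= M.
Proof.
intros Hf.
destruct (uniform_continuity_2d f a b c d Hf (mkposreal 1 Rlt_0_1)) as [e He]; simpl in He.
destruct (nfloor_ex (Rmax 0 ((Rabs (b - a) + Rabs (d - c)) / e))) as [N HN];
  [apply Rmax_l|].
set (n := S N). assert (Hn : 0 < INR n) by (apply lt_0_INR; unfold n; lia).
assert (Hne : Rabs (b - a) + Rabs (d - c) < INR n * e).
{ assert ((Rabs (b - a) + Rabs (d - c)) / e < INR n).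
  { unfold n; rewrite S_INR. eapply Rle_lt_trans; [apply Rmax_r|apply HN]. }
  apply Rmult_lt_compat_r with (r := e) in H; [|apply cond_pos].
  unfold Rdiv in H; rewrite Rmult_assoc, Rinv_l, Rmult_1_r in H; auto.
  apply Rgt_not_eq, cond_pos. }
exists (Rabs (f a c) + INR n). intros x y Hx Hy.
assert (Hs : forall i : nat, (i <= n)%nat ->
  Rabs (f (a + INR i / INR n * (x - a)) (c + INR i / INR n * (y - c)) - f a c) <= INR i).
{ induction i; intros Hi.
  - simpl. unfold Rdiv; rewrite !Rmult_0_l, !Rplus_0_r, Rminus_diag, Rabs_R0; lra.
  - rewrite S_INR. specialize (IHi ltac:(lia)).
    assert (0 <= INR i / INR n <= 1).
    { split; [apply Rdiv_le_0_compat; auto; apply pos_INR|].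
      apply Rmult_le_reg_r with (INR n); auto. unfold Rdiv; rewrite Rmult_assoc, Rinv_l by lra.
      rewrite Rmult_1_r, Rmult_1_l. apply le_INR; lia. }
    assert (Hi1 : 0 <= INR (S i) / INR n <= 1).
    { split; [apply Rdiv_le_0_compat; auto; apply pos_INR|].
      apply Rmult_le_reg_r with (INR n); auto. unfold Rdiv; rewrite Rmult_assoc, Rinv_l by lra.
      rewrite Rmult_1_r, Rmult_1_l. apply le_INR; lia. }
    rewrite S_INR in Hi1.
    assert (E : Rabs (f (a + (INR i + 1) / INR n * (x - a)) (c + (INR i + 1) / INR n * (y - c))
       - f (a + INR i / INR n * (x - a)) (c + INR i / INR n * (y - c))) < 1).
    { apply He; try nra.
      - replace (a + (INR i + 1) / INR n * (x - a) - (a + INR i / INR n * (x - a))) with ((x - a) / INR n) by (field; lra).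
        rewrite Rabs_div by lra. rewrite (Rabs_pos_eq (INR n)) by lra.
        apply Rmult_lt_reg_r with (INR n); auto. unfold Rdiv; rewrite Rmult_assoc, Rinv_l by lra.
        generalize (Rabs_pos (d - c)); revert Hne; rewrite !Rabs_pos_eq; lra.
      - replace (c + (INR i + 1) / INR n * (y - c) - (c + INR i / INR n * (y - c))) with ((y - c) / INR n) by (field; lra).
        rewrite Rabs_div by lra. rewrite (Rabs_pos_eq (INR n)) by lra.
        apply Rmult_lt_reg_r with (INR n); auto. unfold Rdiv; rewrite Rmult_assoc, Rinv_l by lra.
        generalize (Rabs_pos (b - a)); revert Hne; rewrite !Rabs_pos_eq; lra. }
    match goal with |- Rabs (?p - ?q) <= _ =>
      replace (p - q) with ((p - f (a + INR i / INR n * (x - a)) (c + INR i / INR n * (y - c))) +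
       (f (a + INR i / INR n * (x - a)) (c + INR i / INR n * (y - c)) - q)) by ring end.
    eapply Rle_trans; [apply Rabs_triang|]; lra. }
specialize (Hs n (Nat.le_refl n)). unfold Rdiv in Hs; rewrite Rinv_r in Hs by lra.
replace (a + 1 * (x - a)) with x in Hs by ring. replace (c + 1 * (y - c)) with y in Hs by ring.
replace (f x y) with (f a c + (f x y - f a c)) by ring.
eapply Rle_trans; [apply Rabs_triang|]; lra.
Qed.

Definition rect (a b c d x y : R) : Prop := a <= x <= b /\ c <= y <= d.

(** Compactness turns pure regularity into bounds; this is how the constants attached to the
    coefficients arise. *)
Lemma xsmooth_on_rectangle n (U K : R -> R -> Prop) M f a b c d :
  (forall x y, rect a b c d x y -> U x y) ->
  xsmooth n U K M f -> exists M', xsmooth n U (rect a b c d) M' f.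
Proof.
intros HU; revert f; induction n; intros f (Hc & _ & H);
  destruct (bounded_on_rectangle f a b c d) as [M1 H1];
  try (intros; apply Hc, HU; split; auto).
- exists M1; split; [|split]; auto. intros x y [? ?]; auto.
- destruct H as (f' & Hd & H). destruct (IHn f' H) as [M2 H2].
  exists (Rmax M1 M2); split; [|split]; auto.
  + intros x y [? ?]; eapply Rle_trans; [|apply Rmax_l]; auto.
  + exists f'; split; auto. eapply xsmooth_le; [apply Rmax_r|apply H2].
Qed.

Lemma FTC_eq (F f : R -> R) (c y : R) :
  (forall s, is_derive F s (f s)) -> (forall s, continuous f s) ->
  F y = F c + RInt f c y.
Proof.
intros H1 H2.
assert (E : is_RInt f c y (minus (F y) (F c))) by (apply (is_RInt_derive F f); auto).
rewrite (is_RInt_unique (V := R_CompleteNormedModule) _ _ _ _ E). unfold minus, plus, opp; simpl; ring.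
Qed.

Lemma is_derive_RInt_upper (f : R -> R) (c y : R) :
  (forall s, continuous f s) -> is_derive (fun z => RInt f c z) y (f y).
Proof.
intros H. apply (is_derive_RInt f (fun z => RInt f c z) c y); auto.
apply filter_forall; intros z. apply (@RInt_correct R_CompleteNormedModule).
apply (@ex_RInt_continuous R_CompleteNormedModule); auto.
Qed.

(** * Functions of class C1 on open sets of the plane *)

Definition open2 (U : R -> R -> Prop) : Prop :=
  forall x y, U x y -> locally_2d U x y.

(** The partials are explicit arguments, so the closure lemmas compute them as terms. [flux_x] and
    [flux_y] below are written to be convertible with what those lemmas produce. *)
Definition C1_on (U : R -> R -> Prop) (f fx fy : R -> R -> R) : Prop :=
  forall x y, U x y ->
    is_derive (fun z => f z y) x (fx x y) /\ is_derive (f x) y (fy x y) /\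
    continuity_2d_pt fx x y /\ continuity_2d_pt fy x y.

Lemma C1_differentiable U f fx fy x y : open2 U -> C1_on U f fx fy -> U x y ->
  differentiable_pt_lim f x y (fx x y) (fy x y).
Proof.
intros HU Hf Hxy. apply filterdiff_differentiable_pt_lim.
apply (is_derive_filterdiff f x y fx (fy x y)).
- destruct (HU x y Hxy) as [d Hd]. exists d. intros [u v] [Hu Hv]; simpl in *.
  apply Hf, Hd; auto.
- apply Hf, Hxy.
- apply continuity_2d_pt_filterlim. apply Hf, Hxy.
Qed.

Lemma C1_cont U f fx fy x y : open2 U -> C1_on U f fx fy -> U x y ->
  continuity_2d_pt f x y.
Proof.
intros HU Hf Hxy. apply differentiable_continuity_pt.
do 2 eexists. eapply C1_differentiable; eauto.
Qed.

Lemma C1_chain U f fx fy (X : R -> R) X' y : open2 U -> C1_on U f fx fy ->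
  U (X y) y -> is_derive X y X' ->
  is_derive (fun s => f (X s) s) y (fx (X y) y * X' + fy (X y) y).
Proof.
intros HU Hf Hxy HX. apply is_derive_Reals.
replace (fx (X y) y * X' + fy (X y) y) with (fx (X y) y * X' + fy (X y) y * 1) by ring.
apply (derivable_pt_lim_comp_2d f X (fun s => s) y).
- eapply C1_differentiable; eauto.
- now apply is_derive_Reals.
- apply derivable_pt_lim_id.
Qed.

Lemma C1_sub (U U' : R -> R -> Prop) f fx fy :
  (forall x y, U' x y -> U x y) -> C1_on U f fx fy -> C1_on U' f fx fy.
Proof. intros H Hf x y Hxy; apply Hf; auto. Qed.

Lemma C1_plus U f fx fy g gx gy : C1_on U f fx fy -> C1_on U g gx gy ->
  C1_on U (fun x y => f x y + g x y) (fun x y => fx x y + gx x y) (fun x y => fy x y + gy x y).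
Proof.
intros Hf Hg x y Hxy. destruct (Hf x y Hxy) as (F1 & F2 & F3 & F4), (Hg x y Hxy) as (G1 & G2 & G3 & G4).
split; [|split; [|split]].
- apply (@is_derive_plus R_AbsRing R_NormedModule); auto.
- apply (@is_derive_plus R_AbsRing R_NormedModule); auto.
- apply continuity_2d_pt_plus; auto.
- apply continuity_2d_pt_plus; auto.
Qed.

Lemma C1_minus U f fx fy g gx gy : C1_on U f fx fy -> C1_on U g gx gy ->
  C1_on U (fun x y => f x y - g x y) (fun x y => fx x y - gx x y) (fun x y => fy x y - gy x y).
Proof.
intros Hf Hg x y Hxy. destruct (Hf x y Hxy) as (F1 & F2 & F3 & F4), (Hg x y Hxy) as (G1 & G2 & G3 & G4).
split; [|split; [|split]].
- apply (@is_derive_minus R_AbsRing R_NormedModule); auto.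
- apply (@is_derive_minus R_AbsRing R_NormedModule); auto.
- apply continuity_2d_pt_minus; auto.
- apply continuity_2d_pt_minus; auto.
Qed.

Lemma C1_mult U f fx fy g gx gy : open2 U -> C1_on U f fx fy -> C1_on U g gx gy ->
  C1_on U (fun x y => f x y * g x y) (fun x y => fx x y * g x y + f x y * gx x y)
    (fun x y => fy x y * g x y + f x y * gy x y).
Proof.
intros HU Hf Hg x y Hxy.
assert (F0 := C1_cont _ _ _ _ x y HU Hf Hxy). assert (G0 := C1_cont _ _ _ _ x y HU Hg Hxy).
destruct (Hf x y Hxy) as (F1 & F2 & F3 & F4), (Hg x y Hxy) as (G1 & G2 & G3 & G4).
split; [|split; [|split]].
- apply (is_derive_Rmult (fun z => f z y) (fun z => g z y)); auto.
- apply (is_derive_Rmult (f x) (g x)); auto.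
- apply continuity_2d_pt_plus; apply continuity_2d_pt_mult; auto.
- apply continuity_2d_pt_plus; apply continuity_2d_pt_mult; auto.
Qed.

Lemma C1_inv U f fx fy : open2 U -> C1_on U f fx fy -> (forall x y, U x y -> f x y <> 0) ->
  C1_on U (fun x y => / f x y) (fun x y => - (fx x y * (/ f x y * / f x y)))
    (fun x y => - (fy x y * (/ f x y * / f x y))).
Proof.
intros HU Hf Hn x y Hxy.
assert (F0 := C1_cont _ _ _ _ x y HU Hf Hxy).
assert (I0 := continuity_2d_pt_inv _ _ _ F0 (Hn x y Hxy)).
destruct (Hf x y Hxy) as (F1 & F2 & F3 & F4).
split; [|split; [|split]].
- apply (is_derive_Rinv (fun z => f z y)); auto.
- apply (is_derive_Rinv (f x)); auto.
- apply continuity_2d_pt_opp; repeat apply continuity_2d_pt_mult; auto.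
- apply continuity_2d_pt_opp; repeat apply continuity_2d_pt_mult; auto.
Qed.

(** * Trajectories as graphs over the y-axis *)

Lemma is_derive_continuity_pt (f : R -> R) x l : is_derive f x l -> continuity_pt f x.
Proof.
intros H. apply derivable_continuous_pt. exists l. now apply is_derive_Reals.
Qed.

Lemma MVT_derive (f f' : R -> R) a b : a < b ->
  (forall c, a <= c <= b -> is_derive f c (f' c)) ->
  exists c, f b - f a = f' c * (b - a) /\ a < c < b.
Proof.
intros Hab H. apply MVT_cor2; auto. intros c Hc; apply is_derive_Reals, H, Hc.
Qed.

(** T is the supremum of the times up to which z stays positive; if z T were positive, continuity
    would prolong positivity beyond T. *)
Lemma first_exit (z : R -> R) t1 : (forall t, continuity_pt z t) -> 0 < z 0 -> 0 <= t1 ->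
  z t1 <= 0 -> exists T, 0 < T /\ (forall s, 0 <= s < T -> 0 < z s) /\ z T <= 0.
Proof.
intros Hc H0 Ht1 Hz.
set (E := fun t => 0 <= t /\ forall s, 0 <= s <= t -> 0 < z s).
assert (HE0 : E 0) by (split; [lra|]; intros s Hs; replace s with 0 by lra; auto).
assert (Hb : bound E).
{ exists t1. intros t [Ht Hs]. destruct (Rle_or_lt t t1); auto.
  assert (0 < z t1) by (apply Hs; lra). lra. }
destruct (completeness E Hb (ex_intro _ 0 HE0)) as [T [HT1 HT2]].
assert (HT0 : 0 <= T) by (apply HT1, HE0).
assert (Hlt : forall s, 0 <= s < T -> 0 < z s).
{ intros s Hs. apply NNPP; intros Hn.
  assert (T <= s); [|lra]. apply HT2. intros t [Ht Hts].
  destruct (Rle_or_lt t s); auto. exfalso; apply Hn, Hts; lra. }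
assert (HzT : z T <= 0).
{ destruct (Rle_or_lt (z T) 0) as [|Hp]; auto. exfalso.
  destruct (Hc T (z T) Hp) as [e [He Hc']]. simpl in Hc'; unfold R_dist in Hc'.
  assert (HE : E (T + e / 2)).
  { split; [lra|]. intros s Hs. destruct (Rlt_or_le s T); [apply Hlt; lra|].
    destruct (Req_dec s T) as [->|Hne]; auto.
    assert (Hd : Rabs (z s - z T) < z T).
    { apply Hc'. repeat split; auto. rewrite Rabs_pos_eq; lra. }
    apply Rabs_def2 in Hd; lra. }
  apply HT1 in HE; lra. }
exists T; repeat split; auto.
destruct HT0 as [|<-]; auto; lra.
Qed.

(* x cannot reach 0 in finite time because p vanishes linearly there, and
   decreases as long as it is positive; the time-reversed half is obtained by
   applying the lemma to (x(-t), 2c - y(-t)). *)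
Lemma half_trajectory_trapped_onto (p q : R -> R -> R) (x y : R -> R) (D c x0 : R) :
  (forall t, is_derive x t (p (x t) (y t))) ->
  (forall t, is_derive y t (q (x t) (y t))) ->
  x 0 = x0 -> y 0 = c -> 0 < x0 < D ->
  (forall u v, 0 < u < D -> 0 < q u v) ->
  (forall u v, 0 < u < D -> c < v -> p u v < 0) ->
  (forall y1, exists K, forall u v, 0 < u <= x0 -> c <= v <= y1 -> - (K * u) <= p u v) ->
  (forall y1, exists m, 0 < m /\ forall u v, 0 < u <= x0 -> c <= v <= y1 -> m <= q u v) ->
  (forall t, 0 <= t -> 0 < x t <= x0) /\
  (forall y1, c <= y1 -> exists t, 0 <= t /\ y t = y1).
Proof.
intros Hx Hy Hx0 Hy0 H0 Hq Hp HK Hm.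
assert (Cx : forall t, continuity_pt x t) by (intros; eapply is_derive_continuity_pt; apply Hx).
assert (Cy : forall t, continuity_pt y t) by (intros; eapply is_derive_continuity_pt; apply Hy).
assert (Hinc : forall T, (forall s, 0 <= s < T -> 0 < x s < D) ->
   forall s t, 0 <= s < t -> t <= T -> y s < y t).
{ intros T HT s t Hst HtT.
  destruct (MVT_derive y (fun t => q (x t) (y t)) s t) as [r [Hr1 Hr2]]; auto; [lra|].
  assert (0 < q (x r) (y r)) by (apply Hq, HT; lra). nra. }
assert (Hdec : forall T, (forall s, 0 <= s < T -> 0 < x s < D) ->
   forall t, 0 <= t <= T -> x t <= x0).
{ intros T HT t Ht. destruct (Req_dec t 0) as [->|Hne]; [lra|].
  destruct (MVT_derive x (fun t => p (x t) (y t)) 0 t) as [r [Hr1 Hr2]]; auto; [lra|].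
  assert (p (x r) (y r) < 0).
  { apply Hp; [apply HT; lra|]. rewrite <- Hy0; apply Hinc with T; auto; lra. }
  nra. }
assert (Hin : forall t, 0 <= t -> 0 < x t < D).
{ intros t1 Ht1. apply NNPP; intros Hn.
  (* The product x (D - x) is positive exactly when 0 < x < D, so one function watches both walls.
     The wall D is then excluded by x <= x0 < D, leaving an exit through 0. *)
  destruct (first_exit (fun t => x t * (D - x t)) t1) as (T & HT & Hpos & Hend); auto.
  - intros t. apply (continuity_pt_mult x (fun t => D - x t)); auto.
    apply (continuity_pt_minus (fun _ => D) x); auto. apply continuity_pt_const; intros ? ?; auto.
  - rewrite Hx0; nra.
  - apply Rnot_lt_le; intros Hlt; apply Hn.
    destruct (Rlt_or_le 0 (x t1)); destruct (Rlt_or_le (x t1) D); try lra; nra.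
  - assert (HT' : forall s, 0 <= s < T -> 0 < x s < D).
    { intros s Hs. specialize (Hpos s Hs); simpl in Hpos.
      destruct (Rlt_or_le 0 (x s)); destruct (Rlt_or_le (x s) D); try lra; nra. }
    assert (HxT : x T <= x0) by (apply Hdec with T; auto; lra).
    assert (HxT0 : x T <= 0) by (destruct (Rle_or_lt (x T) 0); auto; nra).
    destruct (HK (y T)) as [K HK'].
    (* The derivative of x exp(K s) is (p + K x) exp(K s) >= 0, so this function cannot fall from x0
       > 0 to a nonpositive value at T. *)
    destruct (MVT_derive (fun s => x s * exp (K * s))
       (fun s => p (x s) (y s) * exp (K * s) + x s * (K * exp (K * s))) 0 T) as [r [Hr1 Hr2]]; auto.
    { intros s _. apply (is_derive_Rmult x (fun s => exp (K * s))); auto.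
      rewrite Rmult_comm. apply (is_derive_Rcomp exp (fun s => K * s)).
      - apply is_derive_Reals, derivable_pt_lim_exp.
      - auto_derive; auto; ring. }
    assert (- (K * x r) <= p (x r) (y r)).
    { apply HK'; split.
      - apply HT'; lra.
      - apply Hdec with T; auto; lra.
      - rewrite <- Hy0; left; apply Hinc with T; auto; lra.
      - left; apply Hinc with T; auto; lra. }
    assert (Er := exp_pos (K * r)). assert (ET := exp_pos (K * T)).
    rewrite Rmult_0_r, exp_0 in Hr1.
    assert (0 <= (p (x r) (y r) * exp (K * r) + x r * (K * exp (K * r))) * (T - 0)).
    { apply Rmult_le_pos; [|lra].
      replace (p (x r) (y r) * exp (K * r) + x r * (K * exp (K * r)))
        with ((p (x r) (y r) + K * x r) * exp (K * r)) by ring.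
      apply Rmult_le_pos; lra. }
    assert (x T * exp (K * T) <= 0) by nra. lra. }
split.
- intros t Ht. split; [apply Hin, Ht|]. apply Hdec with t; [intros; apply Hin|]; lra.
- intros y1 Hy1. destruct (Hm y1) as (m & Hm0 & Hm1).
  (* While y stays below y1 its speed is at least m, so in time t1 it would rise by m t1 = y1 - c +
     m, which is too much. *)
  set (t1 := (y1 - c) / m + 1).
  assert (0 < t1) by (unfold t1; assert (0 <= (y1 - c) / m) by (apply Rdiv_le_0_compat; lra); lra).
  assert (Hexc : y1 <= y t1).
  { destruct (Rle_or_lt y1 (y t1)); auto. exfalso.
    destruct (MVT_derive y (fun t => q (x t) (y t)) 0 t1) as [r [Hr1 Hr2]]; auto.
    assert (m <= q (x r) (y r)).
    { assert (HT' : forall s, 0 <= s < t1 -> 0 < x s < D) by (intros; apply Hin; lra).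
      apply Hm1; split.
      - apply Hin; lra.
      - apply Hdec with t1; auto; lra.
      - rewrite <- Hy0; left; apply Hinc with t1; auto; lra.
      - left; apply Rlt_trans with (y t1); auto. apply Hinc with t1; auto; lra. }
    assert (m * t1 = y1 - c + m) by (unfold t1; field; lra). nra. }
  destruct (IVT_gen y 0 t1 y1) as [t [Ht1 Ht2]].
  + exact Cy.
  + rewrite Hy0. rewrite Rmin_left, Rmax_right; lra.
  + exists t; split; auto. rewrite Rmin_left in Ht1; lra.
Qed.

(** Positive speed makes y strictly increasing, so comparing values at t - e and t + e shows its
    right inverse to be continuous; the rule for derivatives of inverse functions then applies. *)
Lemma is_derive_inverse (y tau q : R -> R) :
  (forall t, is_derive y t (q t)) -> (forall t, 0 < q t) -> (forall Y, y (tau Y) = Y) ->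
  forall Y, is_derive tau Y (/ q (tau Y)).
Proof.
intros Hy Hq Ht Y.
assert (Hinc : forall s t, s < t -> y s < y t).
{ intros s t Hst. destruct (MVT_derive y q s t) as [r [Hr1 Hr2]]; auto.
  specialize (Hq r); nra. }
assert (Hinv : forall s t, y s < y t -> s < t).
{ intros s t H. destruct (Rtotal_order s t) as [|[->|H']]; auto; [lra|].
  apply Hinc in H'; lra. }
assert (Hc : continuity_pt tau Y).
{ intros e He. set (t := tau Y).
  assert (H1 : y t < y (t + e)) by (apply Hinc; lra).
  assert (H2 : y (t - e) < y t) by (apply Hinc; lra).
  exists (Rmin (y (t + e) - y t) (y t - y (t - e))); split; [apply Rmin_pos; lra|].
  intros Z [_ HZ]; simpl in *; unfold R_dist in *. fold t.
  assert (Hl := Rmin_l (y (t + e) - y t) (y t - y (t - e))).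
  assert (Hr := Rmin_r (y (t + e) - y t) (y t - y (t - e))).
  assert (HY : y t = Y) by apply Ht. rewrite <- HY in HZ at 1.
  apply Rabs_def2 in HZ.
  apply Rabs_def1.
  - assert (tau Z < t + e); [|lra]. apply Hinv. rewrite Ht. lra.
  - assert (t - e < tau Z); [|lra]. apply Hinv. rewrite Ht. lra. }
assert (Prf : forall a, tau (Y - 1) <= a <= tau (Y + 1) -> derivable_pt y a).
{ intros a _. exists (q a). apply is_derive_Reals, Hy. }
assert (Hm : tau (Y - 1) <= tau Y <= tau (Y + 1)).
{ split; left; apply Hinv; rewrite !Ht; lra. }
assert (E : derive_pt y (tau Y) (Prf (tau Y) Hm) = q (tau Y)).
{ apply derive_pt_eq_0, is_derive_Reals, Hy. }
apply is_derive_Reals. replace (/ q (tau Y)) with (1 / derive_pt y (tau Y) (Prf (tau Y) Hm)).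
- apply (derivable_pt_lim_recip_interv y tau (Y - 1) (Y + 1) Y Prf Hc); try lra.
  + intros z _. apply Ht.
  + rewrite E. apply Rgt_not_eq, Hq.
- rewrite E; unfold Rdiv; ring.
Qed.

(* h = b_x / b_y and k = b_y^2 to the left of x = d/2. *)
Record straightened (eps d L : R) (b : R * R -> R * R)
    (h hx hy k kx ky : R -> R -> R) : Prop := {
  st_eps : 0 < eps;
  st_d : 0 < d;
  st_hx : xsmooth 2 (vstrip (- eps) (d / 2)) (fun _ _ => False) 0 hx;
  st_k : xsmooth 2 (vstrip (- eps) (d / 2)) (fun _ _ => False) 0 k;
  st_hC1 : C1_on (vstrip (- eps) (d / 2)) h hx hy;
  st_kC1 : C1_on (vstrip (- eps) (d / 2)) k kx ky;
  st_b : forall x y, - eps < x < d / 2 ->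
    xcomp b x y = h x y * ycomp b x y /\ 0 < ycomp b x y <= 1 /\ ycomp b x y ^ 2 = k x y;
  st_base : forall x, 0 < x < d / 2 -> h x (L / 2) = 0 /\ k x (L / 2) = 1;
  st_wall : forall y, h 0 y = 0;
  st_below : forall x y, 0 < x < d / 2 -> y < L / 2 -> 0 < h x y;
  st_above : forall x y, 0 < x < d / 2 -> L / 2 < y -> h x y < 0
}.

Arguments st_eps {eps d L b h hx hy k kx ky}.
Arguments st_d {eps d L b h hx hy k kx ky}.
Arguments st_hx {eps d L b h hx hy k kx ky}.
Arguments st_k {eps d L b h hx hy k kx ky}.
Arguments st_hC1 {eps d L b h hx hy k kx ky}.
Arguments st_kC1 {eps d L b h hx hy k kx ky}.
Arguments st_b {eps d L b h hx hy k kx ky}.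
Arguments st_base {eps d L b h hx hy k kx ky}.
Arguments st_wall {eps d L b h hx hy k kx ky}.
Arguments st_below {eps d L b h hx hy k kx ky}.
Arguments st_above {eps d L b h hx hy k kx ky}.

Lemma vstrip_open a b : open2 (vstrip a b).
Proof. intros x y H; apply vstrip_locally, H. Qed.

Lemma st_k_pos eps d L b h hx hy k kx ky x y :
  straightened eps d L b h hx hy k kx ky -> - eps < x < d / 2 -> 0 < k x y.
Proof.
intros Hst Hx. destruct (st_b Hst x y Hx) as (_ & H & <-). nra.
Qed.

(** Upper bound: h vanishes on the wall u = 0, so the mean value theorem gives |h| <= K u, and b_y
    <= 1. Lower bound: 0 < b_y <= 1 gives b_y >= b_y^2 = k, and 1/k is bounded on a compact
    rectangle. Two-sided heights let both time directions use the lemma. *)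
Lemma field_bounds eps d L b h hx hy k kx ky x0 c1 c2 :
  straightened eps d L b h hx hy k kx ky -> 0 < x0 < d / 2 ->
  (exists K, forall u v, 0 < u <= x0 -> c1 <= v <= c2 -> Rabs (xcomp b u v) <= K * u) /\
  (exists m, 0 < m /\ forall u v, 0 < u <= x0 -> c1 <= v <= c2 -> m <= ycomp b u v).
Proof.
intros Hst H0. destruct Hst as [He Hd _ _ Sh Sk Sb _ Sw _ _].
assert (Kp : forall u v, - eps < u < d / 2 -> 0 < k u v).
{ intros u v Hu; destruct (Sb u v Hu) as (_ & ? & <-); nra. }
split.
- destruct (bounded_on_rectangle hx 0 x0 c1 c2) as [K HK].
  { intros u v Hu Hv. apply Sh; unfold vstrip; lra. }
  exists K. intros u v Hu Hv.
  destruct (Sb u v) as (-> & Hb & _); [lra|].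
  destruct (MVT_derive (fun z => h z v) (fun z => hx z v) 0 u) as [r [Hr1 Hr2]]; [lra| |].
  { intros z Hz; apply Sh; unfold vstrip; lra. }
  rewrite Sw, !Rminus_0_r in Hr1. rewrite Hr1, !Rabs_mult.
  assert (HKr : Rabs (hx r v) <= K) by (apply HK; lra).
  rewrite (Rabs_pos_eq u), (Rabs_pos_eq (ycomp b u v)) by lra.
  assert (0 <= Rabs (hx r v) * u) by (apply Rmult_le_pos; [apply Rabs_pos|lra]). nra.
- destruct (bounded_on_rectangle (fun u v => / k u v) 0 x0 c1 c2) as [M HM].
  { intros u v Hu Hv. apply continuity_2d_pt_inv.
    - eapply C1_cont; [apply (vstrip_open (-eps) (d/2))|apply Sk|unfold vstrip; lra].
    - apply Rgt_not_eq, Kp; lra. }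
  (* The absolute value and the added 1 make the witness positive whatever the sign of M. *)
  exists (/ (Rabs M + 1)). split; [apply Rinv_0_lt_compat; generalize (Rabs_pos M); lra|].
  intros u v Hu Hv. specialize (HM u v ltac:(lra) Hv).
  destruct (Sb u v) as (_ & Hb & E); [lra|]. specialize (Kp u v ltac:(lra)).
  apply Rle_trans with (k u v); [|nra].
  rewrite <- (Rinv_inv (k u v)). apply Rinv_le_contravar; [apply Rinv_0_lt_compat; auto|].
  generalize (Rle_abs (/ k u v)) (Rle_abs M); lra.
Qed.

(** A choice operator makes the inverse of t |-> y(t) total; its specification becomes available
    once every height is known to be reached. *)
Definition crossing_time (L : R) (Phi : R -> R * R -> R * R) (x0 Y : R) : R :=
  epsilon (inhabits 0) (fun t => snd (flow_map L Phi x0 t) = Y).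

(** The function X of the graph representation. It is extracted from the given flow, so no existence
    theorem for differential equations enters. *)
Definition xflow (L : R) (Phi : R -> R * R -> R * R) (x0 Y : R) : R :=
  fst (flow_map L Phi x0 (crossing_time L Phi x0 Y)).

Section Trajectory.
Variables (eps d L : R) (b : R * R -> R * R) (h hx hy k kx ky : R -> R -> R)
  (Phi : R -> R * R -> R * R).
Hypothesis Hst : straightened eps d L b h hx hy k kx ky.
Hypothesis HPhi : is_flow eps d L b Phi.
Variable x0 : R.
Hypothesis Hx0 : 0 < x0 < d / 2.

Let x t := fst (flow_map L Phi x0 t).
Let y t := snd (flow_map L Phi x0 t).

Lemma flow_derive t :
  is_derive x t (xcomp b (x t) (y t)) /\ is_derive y t (ycomp b (x t) (y t)).
Proof.
destruct (HPhi x0) as [_ H]; [generalize (st_eps Hst); lra|].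
destruct (H t) as (_ & H1 & H2). unfold xcomp, ycomp, x, y, flow_map.
rewrite <- surjective_pairing. now split.
Qed.

Lemma flow_start : x 0 = x0 /\ y 0 = L / 2.
Proof.
destruct (HPhi x0) as [H _]; [generalize (st_eps Hst); lra|].
unfold x, y, flow_map; rewrite H; now split.
Qed.

Lemma flow_trapped_onto :
  (forall t, 0 < x t <= x0) /\ (forall Y, exists t, y t = Y).
Proof.
destruct flow_start as [Sx Sy]. assert (He := st_eps Hst).
assert (Sb := st_b Hst).
destruct (half_trajectory_trapped_onto (xcomp b) (ycomp b) x y (d / 2) (L / 2) x0) as [F1 F2]; auto.
- intros; apply flow_derive.
- intros; apply flow_derive.
- intros u v Hu; apply Sb; lra.
- intros u v Hu Hv. destruct (Sb u v) as (-> & Hb & _); [lra|].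
  assert (h u v < 0) by (eapply st_above; eauto). nra.
- intros y1. destruct (field_bounds eps d L b h hx hy k kx ky x0 (L / 2) y1 Hst Hx0) as [[K HK] _].
  exists K; intros u v Hu Hv. specialize (HK u v Hu Hv). apply Rabs_le_between in HK; lra.
- intros y1. apply (field_bounds eps d L b h hx hy k kx ky x0 (L / 2) y1 Hst Hx0).
(* The reversed and reflected trajectory follows the field (-b_x, b_y)(u, L - v). Since h > 0 below
   L/2, this field has the signs required above L/2. *)
- destruct (half_trajectory_trapped_onto (fun u v => - xcomp b u (L - v)) (fun u v => ycomp b u (L - v))
    (fun t => x (- t)) (fun t => L - y (- t)) (d / 2) (L / 2) x0) as [G1 G2]; auto.
  + intros t. replace (L - (L - y (- t))) with (y (- t)) by ring.
    replace (- xcomp b (x (- t)) (y (- t))) with (xcomp b (x (- t)) (y (- t)) * -1) by ring.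
    apply (is_derive_Rcomp x (fun t => - t)); [apply flow_derive|]. auto_derive; auto.
  + intros t. replace (L - (L - y (- t))) with (y (- t)) by ring.
    replace (ycomp b (x (- t)) (y (- t))) with (0 - ycomp b (x (- t)) (y (- t)) * -1) by ring.
    apply (@is_derive_minus R_AbsRing R_NormedModule).
    * apply (@is_derive_const R_AbsRing R_NormedModule).
    * apply (is_derive_Rcomp y (fun t => - t)); [apply flow_derive|]. auto_derive; auto.
  + now rewrite Ropp_0.
  + rewrite Ropp_0, Sy; field.
  + intros u v Hu; apply Sb; lra.
  + intros u v Hu Hv. destruct (Sb u (L - v)) as (-> & Hb & _); [lra|].
    assert (0 < h u (L - v)) by (eapply st_below; eauto; lra). nra.
  + intros y1. destruct (field_bounds eps d L b h hx hy k kx ky x0 (L - y1) (L / 2) Hst Hx0) as [[K HK] _].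
    exists K; intros u v Hu Hv. specialize (HK u (L - v) Hu ltac:(lra)). apply Rabs_le_between in HK; lra.
  + intros y1. destruct (field_bounds eps d L b h hx hy k kx ky x0 (L - y1) (L / 2) Hst Hx0) as [_ [m [Hm1 Hm2]]].
    exists m; split; auto. intros u v Hu Hv; apply Hm2; auto; lra.
  + split.
    * intros t. destruct (Rle_or_lt 0 t); [apply F1; auto|].
      rewrite <- (Ropp_involutive t). apply (G1 (- t)); lra.
    * intros Y. destruct (Rle_or_lt (L / 2) Y).
      -- destruct (F2 Y) as [t [_ Ht]]; auto. now exists t.
      -- destruct (G2 (L - Y)) as [t [_ Ht]]; [lra|]. exists (- t). lra.
Qed.

Lemma flow_ycomp_pos t : 0 < ycomp b (x t) (y t) <= 1.
Proof.
assert (He := st_eps Hst). apply (st_b Hst).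
generalize (proj1 flow_trapped_onto t); lra.
Qed.

Lemma flow_increasing s t : s < t -> y s < y t /\ y t - y s <= t - s.
Proof.
intros Hlt.
destruct (MVT_derive y (fun t => ycomp b (x t) (y t)) s t) as [r [Hr1 Hr2]]; auto.
- intros; apply flow_derive.
- generalize (flow_ycomp_pos r); nra.
Qed.

Lemma snd_flow_crossing_time Y : y (crossing_time L Phi x0 Y) = Y.
Proof.
unfold crossing_time. apply epsilon_spec. apply flow_trapped_onto.
Qed.

Lemma crossing_time_le Y Z : Y <= Z -> crossing_time L Phi x0 Y <= crossing_time L Phi x0 Z.
Proof.
intros H. destruct (Rle_or_lt (crossing_time L Phi x0 Y) (crossing_time L Phi x0 Z)) as [|H']; auto.
apply flow_increasing in H'. rewrite !snd_flow_crossing_time in H'; lra.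
Qed.

Lemma crossing_time_snd_flow t : crossing_time L Phi x0 (y t) = t.
Proof.
destruct (Rtotal_order (crossing_time L Phi x0 (y t)) t) as [H|[H|H]]; auto;
apply flow_increasing in H; rewrite snd_flow_crossing_time in H; lra.
Qed.

Lemma crossing_time_start : crossing_time L Phi x0 (L / 2) = 0.
Proof. rewrite <- (proj2 flow_start). apply crossing_time_snd_flow. Qed.

(** As b_y <= 1, the height moves by at most the elapsed time; a bound on time thus confines heights
    to a compact interval. *)
Lemma crossing_time_bound Y : Rabs (Y - L / 2) <= Rabs (crossing_time L Phi x0 Y).
Proof.
destruct flow_start as [_ Sy]. rewrite <- Sy. rewrite <- (snd_flow_crossing_time Y) at 1.
destruct (Rtotal_order (crossing_time L Phi x0 Y) 0) as [H|[->|H]].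
- generalize (flow_increasing _ _ H); intros. rewrite !Rabs_left1; lra.
- rewrite Rminus_diag; lra.
- generalize (flow_increasing _ _ H); intros. rewrite !Rabs_pos_eq; lra.
Qed.

Lemma xflow_range Y : 0 < xflow L Phi x0 Y <= x0.
Proof. apply flow_trapped_onto. Qed.

Lemma xflow_start : xflow L Phi x0 (L / 2) = x0.
Proof. unfold xflow. rewrite crossing_time_start. apply flow_start. Qed.

(** Chain rule through the crossing time: x'(t) / y'(t) = b_x / b_y = h. *)
Lemma is_derive_xflow Y : is_derive (xflow L Phi x0) Y (h (xflow L Phi x0 Y) Y).
Proof.
assert (He := st_eps Hst).
assert (Hb : forall t, 0 < ycomp b (x t) (y t)) by (intros t; apply flow_ycomp_pos).
replace (h (xflow L Phi x0 Y) Y) with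
  (xcomp b (x (crossing_time L Phi x0 Y)) (y (crossing_time L Phi x0 Y)) *
    / ycomp b (x (crossing_time L Phi x0 Y)) (y (crossing_time L Phi x0 Y))).
- apply (is_derive_Rcomp x (crossing_time L Phi x0)); [apply flow_derive|].
  apply (is_derive_inverse y (crossing_time L Phi x0) (fun t => ycomp b (x t) (y t))); auto.
  + intros; apply flow_derive.
  + apply snd_flow_crossing_time.
- destruct (st_b Hst (x (crossing_time L Phi x0 Y)) (y (crossing_time L Phi x0 Y))) as [-> _].
  + generalize (proj1 flow_trapped_onto (crossing_time L Phi x0 Y)); lra.
  + rewrite Rmult_assoc, Rinv_r, Rmult_1_r by (apply Rgt_not_eq, Hb).
    rewrite snd_flow_crossing_time. reflexivity.
Qed.

End Trajectory.

(** * Differentiability in the initial abscissa *)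

Lemma is_derive_exp_comp (f : R -> R) x f' : is_derive f x f' ->
  is_derive (fun z => exp (f z)) x (exp (f x) * f').
Proof.
intros H. apply (is_derive_Rcomp exp f); auto. apply is_derive_Reals, derivable_pt_lim_exp.
Qed.

(** The function z^2 exp(-2K(s - c)) has a nonpositive derivative at every point of the interval;
    working with the square avoids differentiating |z|. *)
Lemma gronwall_right (z z' : R -> R) c y K : c <= y ->
  (forall s, is_derive z s (z' s)) ->
  (forall s, c <= s <= y -> Rabs (z' s) <= K * Rabs (z s)) ->
  Rabs (z y) <= Rabs (z c) * exp (K * (y - c)).
Proof.
intros Hcy Hz Hb.
destruct (Req_dec c y) as [<-|Hne].
{ rewrite Rminus_diag, Rmult_0_r, exp_0; lra. }
assert (Hl : forall s, is_derive (fun s => -2 * K * (s - c)) s (-2 * K)).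
{ intros s; auto_derive; auto; ring. }
destruct (MVT_derive (fun s => (z s * z s) * exp (-2 * K * (s - c)))
   (fun s => (z' s * z s + z s * z' s) * exp (-2 * K * (s - c)) +
      (z s * z s) * (exp (-2 * K * (s - c)) * (-2 * K))) c y) as [r [Hr1 Hr2]]; [lra| |].
{ intros s Hs. apply (is_derive_Rmult (fun s => z s * z s) (fun s => exp (-2 * K * (s - c)))).
  - apply is_derive_Rmult; auto.
  - apply (is_derive_exp_comp (fun s => -2 * K * (s - c))); auto. }
assert (H1 : z' r * z r <= K * (z r * z r)).
{ eapply Rle_trans; [apply Rle_abs|]. rewrite Rabs_mult.
  replace (z r * z r) with (Rabs (z r) * Rabs (z r)) by (rewrite <- Rabs_mult, Rabs_pos_eq; nra).
  rewrite <- Rmult_assoc. apply Rmult_le_compat_r; [apply Rabs_pos|apply Hb; lra]. }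
assert (H2 : (z' r * z r + z r * z' r) * exp (-2 * K * (r - c)) +
      (z r * z r) * (exp (-2 * K * (r - c)) * (-2 * K)) <= 0).
{ generalize (exp_pos (-2 * K * (r - c))); nra. }
rewrite Rminus_diag, Rmult_0_r, exp_0, Rmult_1_r in Hr1.
assert (H3 : z y * z y * exp (-2 * K * (y - c)) <= z c * z c) by nra.
set (e := exp (K * (y - c))). assert (He : 0 < e) by apply exp_pos.
assert (E : exp (-2 * K * (y - c)) * (e * e) = 1).
{ unfold e; rewrite <- !exp_plus, <- exp_0. f_equal; ring. }
assert (H4 : z y * z y <= (z c * e) * (z c * e)).
{ replace (z y * z y) with (z y * z y * exp (-2 * K * (y - c)) * (e * e)) by (rewrite Rmult_assoc, E; ring).
  replace (z c * e * (z c * e)) with (z c * z c * (e * e)) by ring.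
  apply Rmult_le_compat_r; [apply Rmult_le_pos; lra|exact H3]. }
apply Rsqr_le_abs_0 in H4. rewrite Rabs_mult, (Rabs_pos_eq e) in H4; lra.
Qed.

Lemma gronwall (z z' : R -> R) c y K :
  (forall s, is_derive z s (z' s)) ->
  (forall s, Rmin c y <= s <= Rmax c y -> Rabs (z' s) <= K * Rabs (z s)) ->
  Rabs (z y) <= Rabs (z c) * exp (K * Rabs (y - c)).
Proof.
intros Hz Hb. destruct (Rle_or_lt c y).
- rewrite (Rabs_pos_eq (y - c)) by lra. apply gronwall_right with z'; auto.
  intros; apply Hb; rewrite Rmin_left, Rmax_right; auto.
- rewrite (Rabs_left1 (y - c)) by lra.
  (* The reflection s |-> 2c - s maps [c, 2c - y] onto [y, c] and reduces to the forward case. *)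
  replace (- (y - c)) with ((2 * c - y) - c) by ring.
  replace (z y) with (z (2 * c - (2 * c - y))) by (f_equal; ring).
  replace (Rabs (z c)) with (Rabs (z (2 * c - c))) by (do 2 f_equal; ring).
  apply (gronwall_right (fun s => z (2 * c - s)) (fun s => z' (2 * c - s) * -1)); [lra| |].
  + intros s. apply (is_derive_Rcomp z (fun s => 2 * c - s)); auto. auto_derive; auto; ring.
  + intros s Hs. rewrite Rabs_mult, (Rabs_left1 (-1)) by lra. replace (- -1) with 1 by ring.
    rewrite Rmult_1_r. apply Hb. rewrite Rmin_right, Rmax_left; lra.
Qed.

Lemma is_derive_quadratic (f : R -> R) x l C a b : a < x < b ->
  (forall z, a < z < b -> Rabs (f z - f x - l * (z - x)) <= C * ((z - x) * (z - x))) ->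
  is_derive f x l.
Proof.
intros Hx H. apply is_derive_Reals. intros e He.
destruct (locally_open_interval a b x Hx) as [d1 H1].
assert (HC := Rabs_pos C).
set (d := Rmin d1 (e / (Rabs C + 1))).
assert (Hd : 0 < d) by (unfold d; apply Rmin_pos; [apply cond_pos|apply Rdiv_lt_0_compat; lra]).
exists (mkposreal d Hd); simpl; intros t Ht Hlt.
assert (d <= d1) by apply Rmin_l. assert (Hd2 : d <= e / (Rabs C + 1)) by apply Rmin_r.
assert (Hz : a < x + t < b).
{ apply H1. change (Rabs (x + t - x) < d1). replace (x + t - x) with t by ring. lra. }
specialize (H (x + t) Hz). replace (x + t - x) with t in H by ring.
replace ((f (x + t) - f x) / t - l) with ((f (x + t) - f x - l * t) / t) by (field; auto).
rewrite Rabs_div by auto. assert (Hpt : 0 < Rabs t) by (apply Rabs_pos_lt; auto).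
apply Rmult_lt_reg_r with (Rabs t); auto. unfold Rdiv; rewrite Rmult_assoc, Rinv_l, Rmult_1_r by lra.
eapply Rle_lt_trans; [apply H|].
replace (t * t) with (Rabs t * Rabs t) by (rewrite <- Rabs_mult, Rabs_pos_eq; nra).
rewrite <- Rmult_assoc. apply Rmult_lt_compat_r; auto.
apply Rle_lt_trans with (Rabs C * Rabs t); [apply Rmult_le_compat_r; [lra|apply Rle_abs]|].
assert (Rabs t * (Rabs C + 1) < e); [|nra].
apply Rlt_le_trans with (e / (Rabs C + 1) * (Rabs C + 1)).
- apply Rmult_lt_compat_r; lra.
- right; field; lra.
Qed.

Lemma MVT_between (f f' : R -> R) p q : 
  (forall s, Rmin p q <= s <= Rmax p q -> is_derive f s (f' s)) ->
  exists r, Rmin p q <= r <= Rmax p q /\ f q - f p = f' r * (q - p).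
Proof.
intros H. apply (MVT_gen f p q f').
- intros s Hs; apply H; lra.
- intros s Hs; eapply is_derive_continuity_pt; apply H; lra.
Qed.

Lemma Rabs_le_between_minmax p q r : Rmin p q <= r <= Rmax p q -> Rabs (r - p) <= Rabs (q - p).
Proof.
unfold Rmin, Rmax; destruct (Rle_dec p q); intros;
[rewrite !Rabs_pos_eq|rewrite !Rabs_left1]; lra.
Qed.

(** Only the equation in y and the trapping 0 < X <= x are recorded. Regularity in x is not assumed;
    it is deduced from the equation. *)
Definition scalar_flow (D c : R) (h X : R -> R -> R) : Prop :=
  forall x, 0 < x < D -> X x c = x /\ forall y, 0 < X x y <= x /\
    is_derive (X x) y (h (X x y) y).

Section ScalarFlow.
Variables (e D c : R) (h h1 h2 X : R -> R -> R).
Hypothesis He : 0 < e.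
Hypothesis HX : scalar_flow D c h X.
Hypothesis Hh1 : forall x y, - e < x < D -> is_derive (fun z => h z y) x (h1 x y).
Hypothesis Hh2 : forall x y, - e < x < D -> is_derive (fun z => h1 z y) x (h2 x y).
Hypothesis Ch1 : forall x y, - e < x < D -> continuity_2d_pt h1 x y.
Hypothesis Ch2 : forall x y, - e < x < D -> continuity_2d_pt h2 x y.

Lemma flow_derive_bounds xm r : 0 < xm < D -> exists K, 0 <= K /\
  forall x y, 0 <= x <= xm -> Rabs (y - c) <= r ->
    Rabs (h1 x y) <= K /\ Rabs (h2 x y) <= K.
Proof.
intros Hm.
destruct (bounded_on_rectangle h1 0 xm (c - r) (c + r)) as [K1 H1]; [intros; apply Ch1; lra|].
destruct (bounded_on_rectangle h2 0 xm (c - r) (c + r)) as [K2 H2]; [intros; apply Ch2; lra|].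
exists (Rabs K1 + Rabs K2).
assert (P1 := Rabs_pos K1). assert (P2 := Rabs_pos K2).
split; [lra|]. intros x y Hx Hy. apply Rabs_le_between in Hy.
specialize (H1 x y Hx ltac:(lra)); specialize (H2 x y Hx ltac:(lra)).
generalize (Rle_abs K1) (Rle_abs K2); repeat split; lra.
Qed.

(** Gronwall for the difference of two solutions: both lie in (0, xm], where the mean value theorem
    makes h Lipschitz with constant K. *)
Lemma flow_lipschitz xm r K : 0 < xm < D -> 
  (forall x y, 0 <= x <= xm -> Rabs (y - c) <= r -> Rabs (h1 x y) <= K) ->
  forall x1 x2 y, 0 < x1 <= xm -> 0 < x2 <= xm -> Rabs (y - c) <= r ->
  Rabs (X x1 y - X x2 y) <= Rabs (x1 - x2) * exp (K * Rabs (y - c)).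
Proof.
intros Hm HK x1 x2 y H1 H2 Hy.
destruct (HX x1) as [S1 D1]; [lra|]. destruct (HX x2) as [S2 D2]; [lra|].
replace (x1 - x2) with (X x1 c - X x2 c) by lra.
apply (gronwall (fun s => X x1 s - X x2 s) (fun s => h (X x1 s) s - h (X x2 s) s)).
- intros s. apply (@is_derive_minus R_AbsRing R_NormedModule); [apply D1|apply D2].
- intros s Hs. destruct (D1 s) as [R1 _], (D2 s) as [R2 _].
  apply Rabs_le_between_minmax in Hs.
  assert (Hr : forall r, Rmin (X x2 s) (X x1 s) <= r <= Rmax (X x2 s) (X x1 s) -> 0 <= r <= xm).
  { intros t [T1 T2]; split; [eapply Rle_trans; [|apply T1]; apply Rmin_glb; lra|].
    eapply Rle_trans; [apply T2|]; apply Rmax_lub; lra. }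
  destruct (MVT_between (fun z => h z s) (fun z => h1 z s) (X x2 s) (X x1 s)) as [t [Ht1 Ht2]].
  + intros z Hz; apply Hh1. apply Hr in Hz; lra.
  + rewrite Ht2, Rabs_mult. apply Rmult_le_compat_r; [apply Rabs_pos|]. apply HK; auto; lra.
Qed.

(** Joint continuity combines a Lipschitz bound in x, uniform for heights near y, with the
    continuity in y of the single curve X x. *)
Lemma scalar_flow_cont x y : 0 < x < D -> continuity_2d_pt X x y.
Proof.
(* Taking xm beyond x and r one unit beyond |y - c| leaves room for all nearby points (u, v). *)
intros Hx eps. set (xm := (x + D) / 2). set (r := Rabs (y - c) + 1).
destruct (flow_derive_bounds xm r) as (K & HK0 & HK); [unfold xm; lra|].
destruct (HX x Hx) as [_ Dx].
assert (Cy : continuity_pt (X x) y) by (eapply is_derive_continuity_pt; apply Dx).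
destruct (Cy (eps / 2)) as (d1 & Hd1 & H1); [generalize (cond_pos eps); lra|].
simpl in H1; unfold R_dist in H1.
set (M := exp (K * r)). assert (HM : 0 < M) by apply exp_pos.
destruct (locally_open_interval 0 xm x) as [d2 H2]; [unfold xm; lra|].
set (d := Rmin (Rmin d1 1) (Rmin d2 (eps / 2 / M))).
assert (Hp : 0 < eps / 2 / M).
{ apply Rdiv_lt_0_compat; auto. generalize (cond_pos eps); lra. }
assert (Hd : 0 < d) by (unfold d; repeat apply Rmin_pos; try apply cond_pos; auto; lra).
assert (E1 : d <= d1) by (unfold d; eapply Rle_trans; [apply Rmin_l|apply Rmin_l]).
assert (E2 : d <= 1) by (unfold d; eapply Rle_trans; [apply Rmin_l|apply Rmin_r]).
assert (E3 : d <= d2) by (unfold d; eapply Rle_trans; [apply Rmin_r|apply Rmin_l]).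
assert (E4 : d <= eps / 2 / M) by (unfold d; eapply Rle_trans; [apply Rmin_r|apply Rmin_r]).
exists (mkposreal d Hd); simpl; intros u v Hu Hv.
assert (Hu' : 0 < u < xm) by (apply H2; apply Rlt_le_trans with d; auto).
assert (Hv' : Rabs (v - c) <= r).
{ unfold r. replace (v - c) with ((v - y) + (y - c)) by ring.
  eapply Rle_trans; [apply Rabs_triang|]; lra. }
assert (P1 : Rabs (X u v - X x v) <= Rabs (u - x) * exp (K * Rabs (v - c))).
{ apply flow_lipschitz with xm r; try (unfold xm in *; lra).
  intros; now apply HK. }
assert (P2 : exp (K * Rabs (v - c)) <= M).
{ destruct (Rle_lt_or_eq_dec _ _ (Rmult_le_compat_l K _ _ HK0 Hv')) as [Hlt| ->].
  - left; now apply exp_increasing.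
  - unfold M; lra. }
assert (P3 : Rabs (X x v - X x y) < eps / 2).
{ destruct (Req_dec v y) as [->|Hne]; [rewrite Rminus_diag, Rabs_R0; generalize (cond_pos eps); lra|].
  apply H1. split; [split; auto; exact I|lra]. }
assert (P4 : Rabs (u - x) * M < eps / 2).
{ apply Rlt_le_trans with (eps / 2 / M * M); [apply Rmult_lt_compat_r; lra|right; field; lra]. }
replace (X u v - X x y) with ((X u v - X x v) + (X x v - X x y)) by ring.
eapply Rle_lt_trans; [apply Rabs_triang|].
assert (Rabs (u - x) * exp (K * Rabs (v - c)) <= Rabs (u - x) * M)
 by (apply Rmult_le_compat_l; auto using Rabs_pos). lra.
Qed.

(** The candidate J = exp A solves the linearized equation J' = h1(X) J with J(c) = 1. Dividing the
    difference of two solutions by J leaves a quantity that is constant up to second order in z -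
    x. *)
Lemma scalar_flow_derive x y : 0 < x < D ->
  is_derive (fun z => X z y) x (exp (RInt (fun s => h1 (X x s) s) c y)).
Proof.
intros Hx. set (xm := (x + D) / 2). set (r := Rabs (y - c)).
destruct (flow_derive_bounds xm r) as (K & HK0 & HK); [unfold xm; lra|].
destruct (HX x Hx) as [Sx Dx].
set (A := fun y => RInt (fun s => h1 (X x s) s) c y).
assert (CA : forall s, continuous (fun s => h1 (X x s) s) s).
{ intros s. apply (continuity_2d_pt_section_y (fun u v => h1 (X u v) v) x s).
  apply continuity_2d_pt_comp_x; [apply Ch1; destruct (Dx s); lra|].
  now apply scalar_flow_cont. }
assert (DA : forall s, is_derive A s (h1 (X x s) s)).
{ intros s; apply (is_derive_RInt_upper (fun s => h1 (X x s) s)); auto. }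
assert (BA : forall s, Rmin c y <= s <= Rmax c y -> Rabs (A s) <= K * r).
{ intros s Hs. unfold A. eapply Rle_trans; [apply Rabs_RInt_le with (M := K)|].
  - apply (@ex_RInt_continuous R_CompleteNormedModule); auto.
  - intros t Ht. destruct (Dx t). apply HK; [unfold xm; lra|].
    apply Rabs_le_between_minmax in Ht, Hs. unfold r; lra.
  - apply Rabs_le_between_minmax in Hs. rewrite Rmult_comm.
    apply Rmult_le_compat_l; auto. }
set (M := exp (K * r)). assert (HM : 0 < M) by apply exp_pos.
assert (Hexp : forall t, Rabs t <= K * r -> exp t <= M).
{ intros t Ht. assert (Hle : t <= K * r) by (generalize (Rle_abs t); lra).
  destruct Hle as [Hlt| ->]; [left; now apply exp_increasing|unfold M; lra]. }
(* F = (X(z,.) - X(x,.)) / J has F(c) = z - x and derivative O((z - x)^2). *)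
change (is_derive (fun z => X z y) x (exp (A y))).
(* Origin of the factors: M for exp(A y), r for |y - c| in the mean value theorem, K for h2, M * M
   for two Lipschitz bounds on X z - X x, and the last M for exp(-A t). *)
apply is_derive_quadratic with (C := M * (r * (K * (M * M) * M))) (a := 0) (b := xm); [unfold xm; lra|].
intros z Hz.
destruct (HX z) as [Sz Dz]; [unfold xm in *; lra|].
set (F := fun s => (X z s - X x s) * exp (- A s)).
set (F' := fun s => (h (X z s) s - h (X x s) s) * exp (- A s) +
   (X z s - X x s) * (exp (- A s) * - h1 (X x s) s)).
assert (DF : forall s, is_derive F s (F' s)).
{ intros s. apply (is_derive_Rmult (fun s => X z s - X x s) (fun s => exp (- A s))).
  - apply (@is_derive_minus R_AbsRing R_NormedModule); [apply Dz|apply Dx].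
  - apply (is_derive_exp_comp (fun s => - A s)).
    apply (@is_derive_opp R_AbsRing R_NormedModule); auto. }
destruct (MVT_between F F' c y) as [t [Ht1 Ht2]]; [intros; apply DF|].
assert (Fc : F c = z - x).
{ unfold F, A. rewrite Sz, Sx, RInt_point. change zero with 0. rewrite Ropp_0, exp_0; ring. }
assert (Hty : Rabs (t - c) <= r) by (apply Rabs_le_between_minmax in Ht1; auto).
assert (BF : Rabs (F' t) <= K * (M * M) * M * ((z - x) * (z - x))).
{ unfold F'.
  (* The linear terms cancel: F' is the first-order Taylor remainder of h at X x t, times exp(-A t).
     Two mean value steps express it through h2. *)
  replace ((h (X z t) t - h (X x t) t) * exp (- A t) +
   (X z t - X x t) * (exp (- A t) * - h1 (X x t) t)) with
   ((h (X z t) t - h (X x t) t - h1 (X x t) t * (X z t - X x t)) * exp (- A t)) by ring.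
  assert (L0 : Rabs (X z t - X x t) <= Rabs (z - x) * M).
  { eapply Rle_trans; [apply (flow_lipschitz xm r K); try (unfold xm in *; lra)|].
    - intros; now apply HK.
    - apply Rmult_le_compat_l; [apply Rabs_pos|].
      apply Hexp. rewrite Rabs_pos_eq; [|apply Rmult_le_pos; auto using Rabs_pos].
      now apply Rmult_le_compat_l. }
  destruct (Dz t) as [Rz _], (Dx t) as [Rx _].
  assert (Hbt : forall p q, 0 <= p <= xm -> 0 <= q <= xm ->
     forall s, Rmin p q <= s <= Rmax p q -> 0 <= s <= xm).
  { intros p q Hp Hq s [T1 T2]; split; [eapply Rle_trans; [|apply T1]; apply Rmin_glb; lra|].
    eapply Rle_trans; [apply T2|]; apply Rmax_lub; lra. }
  assert (Ix : 0 <= X x t <= xm) by (unfold xm; lra).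
  assert (Iz : 0 <= X z t <= xm) by (unfold xm in *; lra).
  destruct (MVT_between (fun w => h w t) (fun w => h1 w t) (X x t) (X z t)) as [a [Ha1 Ha2]].
  { intros s Hs; apply Hh1. apply Hbt in Hs; auto. unfold xm in *; lra. }
  assert (Ia := Hbt _ _ Ix Iz a Ha1).
  destruct (MVT_between (fun w => h1 w t) (fun w => h2 w t) (X x t) a) as [a' [Hb1 Hb2]].
  { intros s Hs; apply Hh2. apply Hbt in Hs; auto. unfold xm in *; lra. }
  assert (Ia' := Hbt _ _ Ix Ia a' Hb1).
  rewrite Ha2.
  replace (h1 a t * (X z t - X x t) - h1 (X x t) t * (X z t - X x t)) with
    ((h1 a t - h1 (X x t) t) * (X z t - X x t)) by ring.
  rewrite Hb2, !Rabs_mult. 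
  apply Rabs_le_between_minmax in Ha1.
  assert (K2 : Rabs (h2 a' t) <= K) by (apply HK; auto).
  assert (Z2 : (z - x) * (z - x) = Rabs (z - x) * Rabs (z - x)).
  { rewrite <- Rabs_mult, Rabs_pos_eq; auto; apply Rle_0_sqr. }
  rewrite Z2.
  replace (K * (M * M) * M * (Rabs (z - x) * Rabs (z - x))) with
    (K * (Rabs (z - x) * M) * (Rabs (z - x) * M) * M) by ring.
  assert (Rabs (a - X x t) <= Rabs (z - x) * M) by lra.
  rewrite (Rabs_pos_eq (exp (- A t))) by (left; apply exp_pos).
  apply Rmult_le_compat; [|left; apply exp_pos| |apply Hexp; rewrite Rabs_Ropp; auto].
  - repeat apply Rmult_le_pos; apply Rabs_pos.
  - apply Rmult_le_compat; [|apply Rabs_pos| |auto].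
    + apply Rmult_le_pos; apply Rabs_pos.
    + apply Rmult_le_compat; auto using Rabs_pos. }
assert (Ey : X z y - X x y - exp (A y) * (z - x) = exp (A y) * (F y - F c)).
{ rewrite Fc. unfold F.
  replace (exp (A y) * ((X z y - X x y) * exp (- A y) - (z - x))) with
    ((X z y - X x y) * (exp (A y) * exp (- A y)) - exp (A y) * (z - x)) by ring.
  rewrite <- exp_plus, Rplus_opp_r, exp_0; ring. }
rewrite Ey, Ht2, Rabs_mult, (Rabs_pos_eq (exp (A y))) by (left; apply exp_pos).
rewrite Rabs_mult. fold r.
assert (exp (A y) <= M).
{ apply Hexp, BA. split; [apply Rmin_r|apply Rmax_r]. }
replace (M * (r * (K * (M * M) * M)) * ((z - x) * (z - x))) with
 (M * ((K * (M * M) * M * ((z - x) * (z - x))) * r)) by ring.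
apply Rmult_le_compat; auto; [left; apply exp_pos| |].
- apply Rmult_le_pos; apply Rabs_pos.
- apply Rmult_le_compat_r; auto. apply Rabs_pos.
Qed.

End ScalarFlow.

Definition jac (c : R) (hx X : R -> R -> R) (x y : R) : R :=
  exp (RInt (fun s => hx (X x s) s) c y).

Lemma jac_pos c hx X x y : 0 < jac c hx X x y.
Proof. apply exp_pos. Qed.

(** The inverse of J is the exponential of the opposite integral, so the same bound on the exponent
    serves both and no separate lower bound on J is needed. *)
Lemma xsmooth_jac n r Mh MX : 0 <= Mh -> exists M,
  forall c a b (K V V' : R -> R -> Prop) hx X,
  vstar c r K -> (forall x y, K x y -> a < x < b) ->
  (forall x y, a < x < b -> V (X x y) y) -> (forall x y, K x y -> V' (X x y) y) ->
  xsmooth n V V' Mh hx -> xsmooth n (vstrip a b) K MX X ->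
  xsmooth n (vstrip a b) K M (jac c hx X) /\
  xsmooth n (vstrip a b) K M (fun x y => / jac c hx X x y).
Proof.
intros HMh. destruct (xsmooth_comp n MX) as (C & HC & Hcomp).
destruct (xsmooth_exp n (r * (C * Mh))) as (M & HM).
exists M. intros c a b K V V' hx X Hs HK HV HV' Hh HX.
assert (HI : xsmooth n (vstrip a b) K (r * (C * Mh)) (fun x y => RInt (fun s => hx (X x s) s) c y)).
{ apply (xsmooth_RInt n a b K (C * Mh) (fun x s => hx (X x s) s) c r); auto.
  eapply Hcomp; eauto. }
split; [apply HM, HI|].
assert (HE := HM _ _ _ (xsmooth_opp _ _ _ _ _ HI)).
replace (fun x y => / jac c hx X x y) with
  (fun x y => exp (- RInt (fun s => hx (X x s) s) c y)); auto.
apply functional_extensionality; intros x; apply functional_extensionality; intros y.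
apply exp_Ropp.
Qed.

(** If X has n controlled x-derivatives, so has J by its exponential formula; since dX/dx = J, X
    then has n + 1. The induction starts from the trapping 0 < X <= xm on K. *)
Lemma scalar_flow_xsmooth e D c r h hx hy xm : 0 < e -> 0 < xm < D ->
  C1_on (vstrip (- e) D) h hx hy ->
  xsmooth 2 (vstrip (- e) D) (fun _ _ => False) 0 hx ->
  exists M, 0 <= M /\ forall X K, scalar_flow D c h X -> vstar c r K ->
    (forall x y, K x y -> 0 < x <= xm) ->
    (forall x y, 0 < x < D -> is_derive (fun z => X z y) x (jac c hx X x y)) /\
    (forall x y, 0 < x < D ->
      is_derive (jac c hx X x) y (hx (X x y) y * jac c hx X x y)) /\
    xsmooth 2 (vstrip 0 D) K M X /\
    xsmooth 2 (vstrip 0 D) K M (jac c hx X) /\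
    xsmooth 2 (vstrip 0 D) K M (fun x y => / jac c hx X x y).
Proof.
intros He Hxm Hh Hhx.
destruct (fun H => xsmooth_on_rectangle 2 _ _ _ hx 0 xm (c - r) (c + r) H Hhx) as [M0 H0].
{ intros x y [? ?]; unfold vstrip; lra. }
set (Mh := Rmax 0 M0). assert (HMh : 0 <= Mh) by apply Rmax_l.
assert (H1 : xsmooth 2 (vstrip (- e) D) (rect 0 xm (c - r) (c + r)) Mh hx).
{ eapply xsmooth_le; [apply Rmax_r|apply H0]. }
(* The bounds for the three rounds are computed from xm, r and Mh before X and K are introduced, so
   the final M is uniform in them. *)
destruct (xsmooth_jac 0 r Mh xm HMh) as [M1 J1].
set (m1 := Rmax xm M1). destruct (xsmooth_jac 1 r Mh m1 HMh) as [M2 J2].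
set (m2 := Rmax xm M2). destruct (xsmooth_jac 2 r Mh m2 HMh) as [M3 J3].
exists (Rmax xm (Rmax m2 M3)). split.
{ apply Rle_trans with xm; [lra|apply Rmax_l]. }
intros X K HX HK HKx.
assert (Hxc : forall x y, - e < x < D -> continuity_2d_pt hx x y).
{ intros; apply Hh; auto. }
destruct Hhx as (_ & _ & h2 & D2 & Hh2).
assert (XC : forall x y, 0 < x < D -> continuity_2d_pt X x y).
{ apply (scalar_flow_cont e D c h hx h2); auto.
  - intros; apply Hh; auto.
  - intros; eapply xsmooth_cont; eauto. }
assert (XD : forall x y, 0 < x < D -> is_derive (fun z => X z y) x (jac c hx X x y)).
{ apply (scalar_flow_derive e D c h hx h2); auto.
  - intros; apply Hh; auto.
  - intros; eapply xsmooth_cont; eauto. }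
assert (HV : forall x y, 0 < x < D -> vstrip (- e) D (X x y) y).
{ intros x y Hx. destruct (HX x Hx) as [_ H]. destruct (H y). unfold vstrip; lra. }
assert (HKD : forall x y, K x y -> 0 < x < D).
{ intros x y Hk; apply HKx in Hk; lra. }
assert (HV' : forall x y, K x y -> rect 0 xm (c - r) (c + r) (X x y) y).
{ intros x y Hk. destruct (HX x (HKD x y Hk)) as [_ H]. destruct (H y).
  specialize (HKx x y Hk). split; [lra|]. destruct (HK x y Hk) as [Hr _].
  apply Rabs_le_between in Hr; lra. }
assert (X0 : xsmooth 0 (vstrip 0 D) K xm X).
{ split; [|split]; auto. intros x y Hk. destruct (HV' x y Hk) as [? _].
  rewrite Rabs_pos_eq; lra. }
assert (Hup : forall n M, xsmooth n (vstrip 0 D) K M (jac c hx X) ->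
   xsmooth (S n) (vstrip 0 D) K (Rmax xm M) X).
{ intros n M HJ. split; [|split]; auto.
  - intros x y Hk; eapply Rle_trans; [eapply (xsmooth_bound 0); eauto|apply Rmax_l].
  - exists (jac c hx X); split; auto. eapply xsmooth_le; [apply Rmax_r|auto]. }
assert (X1 : xsmooth 1 (vstrip 0 D) K m1 X).
{ apply Hup. eapply J1; eauto. do 2 apply xsmooth_pred; auto. }
assert (X2 : xsmooth 2 (vstrip 0 D) K m2 X).
{ apply Hup. eapply J2; eauto. apply xsmooth_pred; auto. }
destruct (J3 c 0 D K (vstrip (- e) D) (rect 0 xm (c - r) (c + r)) hx X) as [HJ HiJ]; auto.
split; [auto|split; [|split; [|split]]].
- intros x y Hx. rewrite Rmult_comm. apply (is_derive_exp_comp (fun y => RInt (fun s => hx (X x s) s) c y)).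
  apply (is_derive_RInt_upper (fun s => hx (X x s) s)). intros s.
  apply (continuity_2d_pt_section_y (fun u v => hx (X u v) v) x s).
  apply continuity_2d_pt_comp_x; auto. apply Hxc, HV, Hx.
- apply xsmooth_le with m2; auto. apply Rle_trans with (Rmax m2 M3); [apply Rmax_l|apply Rmax_r].
- apply xsmooth_le with M3; auto. apply Rle_trans with (Rmax m2 M3); [apply Rmax_r|apply Rmax_r].
- apply xsmooth_le with M3; auto. apply Rle_trans with (Rmax m2 M3); [apply Rmax_r|apply Rmax_r].
Qed.

(* The bounds on vx come from the identity vx(X,y) J = dV/dx0; no inverse of the
   flow map is needed. *)
Lemma xsmooth_pullback_derivative n a b (K : R -> R -> Prop) B MJ
    (v vx X J V : R -> R -> R) :
  (forall x y, a < x < b -> is_derive (fun z => X z y) x (J x y)) ->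
  (forall x y, a < x < b -> J x y <> 0) ->
  (forall x y, a < x < b -> is_derive (fun z => v z y) (X x y) (vx (X x y) y)) ->
  (forall x y, a < x < b -> v (X x y) y = V x y) ->
  xsmooth (S n) (vstrip a b) K B V ->
  xsmooth n (vstrip a b) K MJ (fun x y => / J x y) ->
  exists V1, (forall x y, a < x < b -> vx (X x y) y = V1 x y) /\
    xsmooth n (vstrip a b) K (2 ^ n * (B * MJ)) V1.
Proof.
intros HX HJ Hv HV (_ & _ & V' & DV & HV') HiJ.
exists (fun x y => V' x y * / J x y). split; [|apply xsmooth_mult; auto].
intros x y Hx.
assert (E : is_derive (fun z => v (X z y) y) x (vx (X x y) y * J x y)).
{ apply (is_derive_Rcomp (fun z => v z y) (fun z => X z y)); auto. }
assert (E' : is_derive (fun z => v (X z y) y) x (V' x y)).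
{ apply is_derive_ext_loc with (fun z => V z y); [|apply DV, Hx].
  generalize (locally_open_interval a b x Hx); apply filter_imp; intros z Hz; symmetry; auto. }
apply is_derive_unique in E. apply is_derive_unique in E'. rewrite E in E'.
rewrite <- E'. field; auto.
Qed.

(** * Solutions along the flow *)

Lemma Rabs_mult_le a b A B : Rabs a <= A -> Rabs b <= B -> Rabs (a * b) <= A * B.
Proof. intros; rewrite Rabs_mult; apply Rmult_le_compat; auto using Rabs_pos. Qed.

Lemma Rabs_plus_le a b A B : Rabs a <= A -> Rabs b <= B -> Rabs (a + b) <= A + B.
Proof. intros; eapply Rle_trans; [apply Rabs_triang|]; lra. Qed.

Lemma Rabs_minus_le a b A B : Rabs a <= A -> Rabs b <= B -> Rabs (a - b) <= A + B.
Proof. intros; apply Rabs_plus_le; auto. now rewrite Rabs_Ropp. Qed.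

(* The bounds obtained by solving the definition of m, its x-derivative and the
   equation for wy, wxy and wyy, summed. *)
Definition second_order_const (H : R) : R :=
  1 + 2 * H + ((1 + H * (1 * H)) * H + H * 1 + H * 1)
  + ((1 + H * 1 + H * 1 + H * (1 * H)) * H + H * 1
     + H * ((1 + H * (1 * H)) * H + H * 1 + H * 1)).

Lemma second_order_bounds (H B h hx hy k kx ky g w wx wy wxx wxy wyy : R) :
  let m := k * (h * wx + wy) in
  let mx := kx * (h * wx + wy) + k * (hx * wx + h * wxx + wxy) in
  let my := ky * (h * wx + wy) + k * (hy * wx + h * wxy + wyy) in
  k <> 0 -> Rabs (/ k) <= H -> Rabs h <= H -> Rabs hx <= H -> Rabs hy <= H ->
  Rabs kx <= H -> Rabs ky <= H -> hx * m + h * mx + my = - g ->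
  Rabs g <= B -> Rabs w <= B -> Rabs wx <= B -> Rabs wxx <= B ->
  Rabs m <= B -> Rabs mx <= B ->
  Rabs w <= second_order_const H * B /\ Rabs wx <= second_order_const H * B /\
  Rabs wy <= second_order_const H * B /\ Rabs wxx <= second_order_const H * B /\
  Rabs wxy <= second_order_const H * B /\ Rabs wyy <= second_order_const H * B.
Proof.
intros m mx my Hk Hik Hh Hhx Hhy Hkx Hky Heq Hg Hw Hwx Hwxx Hm Hmx.
assert (PH : 0 <= H) by (eapply Rle_trans; [apply Rabs_pos|apply Hh]).
assert (PB : 0 <= B) by (eapply Rle_trans; [apply Rabs_pos|apply Hg]).
assert (Ey : wy = m * / k - h * wx) by (unfold m; field; auto).
assert (Exy : wxy = (mx - kx * (m * / k)) * / k - hx * wx - h * wxx)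
  by (unfold m, mx; field; auto).
assert (Eyy : wyy = (- g - hx * m - h * mx - ky * (m * / k)) * / k - hy * wx - h * wxy).
{ replace (- g - hx * m - h * mx) with my by lra. unfold m, my; field; auto. }
assert (By : Rabs wy <= B * H + H * B).
{ rewrite Ey. apply Rabs_minus_le; apply Rabs_mult_le; auto. }
assert (Bxy : Rabs wxy <= (B + H * (B * H)) * H + H * B + H * B).
{ rewrite Exy. repeat (apply Rabs_minus_le || apply Rabs_mult_le); auto. }
assert (Byy : Rabs wyy <= (B + H * B + H * B + H * (B * H)) * H + H * B
   + H * ((B + H * (B * H)) * H + H * B + H * B)).
{ rewrite Eyy. repeat (apply Rabs_minus_le || apply Rabs_mult_le); auto.
  now rewrite Rabs_Ropp. }
clear - PH PB By Bxy Byy Hw Hwx Hwxx.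
(* P1, P2 and P3 are the bounds on wy, wxy and wyy with B factored out; the factors 1 mark the
   places where B stood. *)
set (P1 := 2 * H * B). set (P2 := ((1 + H * (1 * H)) * H + H * 1 + H * 1) * B).
set (P3 := ((1 + H * 1 + H * 1 + H * (1 * H)) * H + H * 1
     + H * ((1 + H * (1 * H)) * H + H * 1 + H * 1)) * B).
assert (E : second_order_const H * B = B + P1 + P2 + P3) by (unfold second_order_const, P1, P2, P3; ring).
rewrite E.
assert (Q1 : 0 <= P1) by (unfold P1; repeat (apply Rmult_le_pos || apply Rplus_le_le_0_compat); lra).
assert (Q2 : 0 <= P2) by (unfold P2; repeat (apply Rmult_le_pos || apply Rplus_le_le_0_compat); lra).
assert (Q3 : 0 <= P3) by (unfold P3; repeat (apply Rmult_le_pos || apply Rplus_le_le_0_compat); lra).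
replace (B * H + H * B) with P1 in By by (unfold P1; ring).
replace ((B + H * (B * H)) * H + H * B + H * B) with P2 in Bxy by (unfold P2; ring).
replace ((B + H * B + H * B + H * (B * H)) * H + H * B
   + H * ((B + H * (B * H)) * H + H * B + H * B)) with P3 in Byy by (unfold P3; ring).
repeat split; lra.
Qed.

Section Representation.
Variables (eps d L : R) (b : R * R -> R * R) (h hx hy k kx ky : R -> R -> R).
Hypothesis Hst : straightened eps d L b h hx hy k kx ky.
Variables (alpha : R) (X : R -> R -> R) (A : R -> R -> Prop).
Hypothesis Halpha : 0 < alpha < d / 2.
Hypothesis HX : scalar_flow (d / 2) (L / 2) h X.
Let J := jac (L / 2) hx X.
Hypothesis HXd : forall x y, 0 < x < d / 2 -> is_derive (fun z => X z y) x (J x y).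
Hypothesis HJd : forall x y, 0 < x < d / 2 -> is_derive (J x) y (hx (X x y) y * J x y).
Hypothesis CX : forall x y, 0 < x < d / 2 -> continuity_2d_pt X x y.
Hypothesis CJ : forall x y, 0 < x < d / 2 -> continuity_2d_pt J x y.
Hypothesis HA : open2 A.
Hypothesis HXA : forall x y, 0 < x < alpha -> A (X x y) y.
Hypothesis HAstrip : forall x y, A x y -> - eps < x < d / 2.
Variables (g w wx wy wxx wxy wyy : R -> R -> R) (p q : R -> R).
Hypothesis Cg : forall x y, A x y -> continuity_2d_pt g x y.
Hypothesis Hw : C1_on A w wx wy.
Hypothesis Hwx : C1_on A wx wxx wxy.
Hypothesis Hwy : C1_on A wy wxy wyy.

(** The vertical component of (b ⊗ b)∇w, written with k = b_y^2 and h = b_x / b_y; the horizontal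
    component is h times it. *)
Definition flux (x y : R) : R := k x y * (h x y * wx x y + wy x y).
Definition flux_x (x y : R) : R :=
  kx x y * (h x y * wx x y + wy x y)
  + k x y * (hx x y * wx x y + h x y * wxx x y + wxy x y).
Definition flux_y (x y : R) : R :=
  ky x y * (h x y * wx x y + wy x y)
  + k x y * (hy x y * wx x y + h x y * wxy x y + wyy x y).

Hypothesis Heq : forall x y, A x y ->
  hx x y * flux x y + h x y * flux_x x y + flux_y x y = - g x y.
Hypothesis Hp : forall x, 0 < x < alpha -> w x (L / 2) = p x.
Hypothesis Hq : forall x, 0 < x < alpha -> wy x (L / 2) = q x.

Lemma C1_flux : C1_on A flux flux_x flux_y.
Proof.
assert (Hh : C1_on A h hx hy) by (eapply C1_sub; [apply HAstrip|apply Hst]).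
assert (Hk : C1_on A k kx ky) by (eapply C1_sub; [apply HAstrip|apply Hst]).
exact (C1_mult _ _ _ _ _ _ _ HA Hk (C1_plus _ _ _ _ _ _ _ (C1_mult _ _ _ _ _ _ _ HA Hh Hwx) Hwy)).
Qed.

(** J is an integrating factor: J' = h_x J supplies the term h_x m that is missing from the
    derivative of m along a trajectory, so the equation becomes an exact derivative. *)
Lemma flux_along_flow x y : 0 < x < alpha ->
  flux (X x y) y = (q x + RInt (fun s => - (g (X x s) s * J x s)) (L / 2) y) * / J x y.
Proof.
intros Hx. destruct (HX x) as [Xc Xd]; [lra|].
assert (HJ : J x y <> 0) by (apply Rgt_not_eq, jac_pos).
assert (E : flux (X x y) y * J x y = flux (X x (L / 2)) (L / 2) * J x (L / 2) +
   RInt (fun s => - (g (X x s) s * J x s)) (L / 2) y).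
{ apply (FTC_eq (fun s => flux (X x s) s * J x s) (fun s => - (g (X x s) s * J x s))).
  - intros s. replace (- (g (X x s) s * J x s)) with
     ((flux_x (X x s) s * h (X x s) s + flux_y (X x s) s) * J x s +
      flux (X x s) s * (hx (X x s) s * J x s)).
    + apply (is_derive_Rmult (fun s => flux (X x s) s) (J x)); [|apply HJd; lra].
      apply (C1_chain A flux flux_x flux_y (X x)); auto; [apply C1_flux|apply Xd].
    + assert (E := Heq (X x s) s (HXA x s Hx)). 
      replace (g (X x s) s) with (- (- g (X x s) s)) by ring. rewrite <- E. ring.
  - intros s.
    apply (continuity_2d_pt_section_y (fun u v => - (g (X u v) v * J u v)) x s).
    apply continuity_2d_pt_opp, continuity_2d_pt_mult; [|apply CJ; lra].
    apply continuity_2d_pt_comp_x; [apply Cg, HXA, Hx|apply CX; lra]. }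
(* At the base height J = 1, h = 0 and k = 1, so the flux reduces to wy, which is prescribed by
   q. *)
assert (E0 : flux (X x (L / 2)) (L / 2) * J x (L / 2) = q x).
{ rewrite Xc. unfold J, jac. rewrite RInt_point. change zero with 0. rewrite exp_0.
  unfold flux. destruct (st_base Hst x) as [-> ->]; [lra|].
  rewrite Hq by auto. ring. }
rewrite E0 in E. rewrite <- E. field; auto.
Qed.

Lemma solution_along_flow x y : 0 < x < alpha ->
  w (X x y) y = p x + RInt (fun s => flux (X x s) s * / k (X x s) s) (L / 2) y.
Proof.
intros Hx. destruct (HX x) as [Xc Xd]; [lra|].
assert (Hk : forall s, k (X x s) s <> 0).
{ intros s. apply Rgt_not_eq. eapply st_k_pos; eauto. }
replace (p x) with (w (X x (L / 2)) (L / 2)) by (rewrite Xc; auto).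
apply (FTC_eq (fun s => w (X x s) s) (fun s => flux (X x s) s * / k (X x s) s)).
- intros s. replace (flux (X x s) s * / k (X x s) s) with
    (wx (X x s) s * h (X x s) s + wy (X x s) s) by (unfold flux; field; auto).
  apply (C1_chain A w wx wy (X x)); auto. apply Xd.
- intros s.
  apply (continuity_2d_pt_section_y (fun u v => flux (X u v) v * / k (X u v) v) x s).
  assert (CXs : continuity_2d_pt X x s) by (apply CX; lra).
  apply continuity_2d_pt_mult.
  + apply continuity_2d_pt_comp_x; auto.
    apply (C1_cont A flux flux_x flux_y); auto. apply C1_flux.
  + apply continuity_2d_pt_inv; auto. apply continuity_2d_pt_comp_x; auto.
    apply (C1_cont (vstrip (- eps) (d / 2)) k kx ky); [apply vstrip_open|apply Hst|].
    apply (HAstrip _ s); auto.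
Qed.

End Representation.

(** [C] is fixed before the flow, the sets and the data, so it depends on the coefficients, alpha
    and r only. Regularity is required on A, while the size S of g is required only on A', which
    contains the image of K. *)
Lemma solution_estimate eps d L b h hx hy k kx ky alpha r :
  straightened eps d L b h hx hy k kx ky -> 0 < alpha < d / 2 -> 0 <= r ->
  exists C, 0 < C /\
  forall X (K A A' : R -> R -> Prop) S g w wx wy wxx wxy wyy (p q : R -> R),
  scalar_flow (d / 2) (L / 2) h X ->
  vstar (L / 2) r K -> (forall x y, K x y -> 0 < x < alpha) ->
  open2 A -> (forall x y, 0 < x < alpha -> A (X x y) y) ->
  (forall x y, A x y -> - eps < x < d / 2) -> (forall x y, K x y -> A' (X x y) y) ->
  C1_on A w wx wy -> C1_on A wx wxx wxy -> C1_on A wy wxy wyy ->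
  (forall x y, A x y -> hx x y * flux h k wx wy x y
     + h x y * flux_x h hx k kx wx wy wxx wxy x y
     + flux_y h hy k ky wx wy wxy wyy x y = - g x y) ->
  (forall x, 0 < x < alpha -> w x (L / 2) = p x) ->
  (forall x, 0 < x < alpha -> wy x (L / 2) = q x) ->
  0 <= S -> xsmooth 2 A A' S g ->
  xsmooth 2 (vstrip 0 alpha) K S (fun x _ => p x) ->
  xsmooth 2 (vstrip 0 alpha) K S (fun x _ => q x) ->
  forall x0 y, K x0 y -> let x := X x0 y in
  Rabs (w x y) <= C * S /\ Rabs (wx x y) <= C * S /\ Rabs (wy x y) <= C * S /\
  Rabs (wxx x y) <= C * S /\ Rabs (wxy x y) <= C * S /\ Rabs (wyy x y) <= C * S.
Proof.
intros Hst Ha Hr.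
assert (He := st_eps Hst).
assert (Hh := st_hC1 Hst).
assert (Hk := st_kC1 Hst).
assert (Hkpos : forall x y, - eps < x < d / 2 -> 0 < k x y).
{ intros; eapply st_k_pos; eauto. }
destruct (scalar_flow_xsmooth eps (d / 2) (L / 2) r h hx hy alpha He Ha Hh
  (st_hx Hst)) as (M & HM & HXs).
set (R0 := rect 0 alpha (L / 2 - r) (L / 2 + r)).
set (U := vstrip (- eps) (d / 2)).
assert (HRU : forall x y, R0 x y -> U x y) by (intros x y [? ?]; unfold U, vstrip; lra).
(* With an empty set of bounds the two numbers are placeholders: only regularity of 1/k is obtained
   here, and its bounds come from the rectangle. *)
destruct (xsmooth_inv 2 0 0) as [M0 HM0].
assert (Hik : xsmooth 2 U (fun _ _ => False) M0 (fun x y => / k x y)).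
{ apply HM0; try tauto; [apply Hst|]. intros x y Hxy; apply Rgt_not_eq, Hkpos, Hxy. }
destruct (xsmooth_on_rectangle _ _ _ _ _ _ _ _ _ HRU Hik) as [M1 HM1].
set (Mik := Rmax 0 M1). assert (PMik : 0 <= Mik) by apply Rmax_l.
assert (Hik' : xsmooth 2 U R0 Mik (fun x y => / k x y)).
{ eapply xsmooth_le; [apply Rmax_r|apply HM1]. }
assert (HB : forall f, (forall x y, U x y -> continuity_2d_pt f x y) -> 
  exists B, 0 <= B /\ forall x y, R0 x y -> Rabs (f x y) <= B).
{ intros f Hf. destruct (bounded_on_rectangle f 0 alpha (L / 2 - r) (L / 2 + r)) as [B HB].
  - intros x y Hx Hy; apply Hf, HRU; split; auto.
  - exists (Rmax 0 B); split; [apply Rmax_l|]. intros x y [Hx Hy].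
    eapply Rle_trans; [apply HB; auto|apply Rmax_r]. }
destruct (HB h) as (B1 & P1 & HB1).
{ intros; eapply C1_cont; [apply vstrip_open|apply Hh|auto]. }
destruct (HB hx) as (B2 & P2 & HB2); [intros; apply Hh; auto|].
destruct (HB hy) as (B3 & P3 & HB3); [intros; apply Hh; auto|].
destruct (HB kx) as (B4 & P4 & HB4); [intros; apply Hk; auto|].
destruct (HB ky) as (B5 & P5 & HB5); [intros; apply Hk; auto|].
destruct (xsmooth_comp 2 M) as (C1 & PC1 & HC1).
set (H := Mik + B1 + B2 + B3 + B4 + B5).
(* Per unit of S, the constants cN, cm, cG and cW bound m J, m, m/k and w in the coordinates (x0,
   y), with two x0-derivatives; c1, c2 and c3 bound wx, wxx and m_x. Here r comes from integration
   in y, C1 from composition with X, and M from J or 1/J. *)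
set (cN := 1 + r * (2 ^ 2 * (C1 * M))).
set (cm := 2 ^ 2 * (cN * M)).
set (cG := 2 ^ 2 * (cm * (C1 * Mik))).
set (cW := 1 + r * cG).
set (c1 := 2 ^ 1 * (cW * M)).
set (c2 := 2 ^ 0 * (c1 * M)).
set (c3 := 2 ^ 1 * (cm * M)).
assert (HcN : 0 <= cN) by (unfold cN; repeat (apply Rmult_le_pos || apply Rplus_le_le_0_compat || apply pow_le); lra).
assert (Hcm : 0 <= cm) by (unfold cm; repeat (apply Rmult_le_pos || apply pow_le); lra).
assert (HcG : 0 <= cG) by (unfold cG; repeat (apply Rmult_le_pos || apply pow_le); lra).
assert (HcW : 0 <= cW) by (unfold cW; repeat (apply Rmult_le_pos || apply Rplus_le_le_0_compat); lra).
assert (Hc1 : 0 <= c1) by (unfold c1; repeat (apply Rmult_le_pos || apply pow_le); lra).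
assert (Hc2 : 0 <= c2) by (unfold c2; repeat (apply Rmult_le_pos || apply pow_le); lra).
assert (Hc3 : 0 <= c3) by (unfold c3; repeat (apply Rmult_le_pos || apply pow_le); lra).
set (c := 1 + cW + c1 + c2 + cm + c3).
assert (PH : 0 <= H) by (unfold H; lra).
assert (Palg : 0 < second_order_const H).
{ unfold second_order_const. assert (0 <= 2 * H) by lra.
  assert (0 <= (1 + H * (1 * H)) * H + H * 1 + H * 1)
    by (repeat (apply Rmult_le_pos || apply Rplus_le_le_0_compat); lra).
  assert (0 <= (1 + H * 1 + H * 1 + H * (1 * H)) * H + H * 1
     + H * ((1 + H * (1 * H)) * H + H * 1 + H * 1))
    by (repeat (apply Rmult_le_pos || apply Rplus_le_le_0_compat); lra). lra. }
exists (second_order_const H * c). split; [apply Rmult_lt_0_compat; unfold c; lra|].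
intros X K A A' S g w wx wy wxx wxy wyy p q HX HKs HK HA HXA HAs HKA Hw Hwx Hwy Heq Hp Hq HS Hg Hps Hqs.
destruct (HXs X K HX HKs) as (HXd & HJd & SX & SJ & SiJ).
{ intros x y Hk0; apply HK in Hk0; lra. }
set (J := jac (L / 2) hx X) in *.
assert (CX : forall x y, 0 < x < d / 2 -> continuity_2d_pt X x y)
  by (intros; eapply xsmooth_cont; eauto).
assert (CJ : forall x y, 0 < x < d / 2 -> continuity_2d_pt J x y)
  by (intros; eapply xsmooth_cont; eauto).
assert (Cg : forall x y, A x y -> continuity_2d_pt g x y)
  by (intros; eapply xsmooth_cont; eauto).
assert (Hsub : forall x y, vstrip 0 alpha x y -> vstrip 0 (d / 2) x y) by (unfold vstrip; intros; lra).
apply (xsmooth_sub _ _ (vstrip 0 alpha) K K) in SX; auto.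
apply (xsmooth_sub _ _ (vstrip 0 alpha) K K) in SJ; auto.
apply (xsmooth_sub _ _ (vstrip 0 alpha) K K) in SiJ; auto.
assert (HKR : forall x y, K x y -> R0 (X x y) y).
{ intros x y Hk0. assert (Hx := HK x y Hk0). destruct (HX x) as [_ HXx]; [lra|].
  destruct (HXx y) as [? _]. destruct (HKs x y Hk0) as [Hy _]. apply Rabs_le_between in Hy.
  split; lra. }
set (m := flux h k wx wy). set (mx := flux_x h hx k kx wx wy wxx wxy).
set (N := fun x y => q x + RInt (fun s => - (g (X x s) s * J x s)) (L / 2) y).
assert (SN : xsmooth 2 (vstrip 0 alpha) K (cN * S) N).
{ replace (cN * S) with (S + r * (2 ^ 2 * (C1 * S * M))) by (unfold cN; ring).
  apply xsmooth_plus; auto.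
  apply (xsmooth_RInt 2 0 alpha K _ (fun x s => - (g (X x s) s * J x s))); auto.
  apply xsmooth_opp, xsmooth_mult; auto.
  apply (HC1 _ _ A A'); auto. }
set (Vm := fun x y => N x y * / J x y).
assert (SVm : xsmooth 2 (vstrip 0 alpha) K (cm * S) Vm).
{ replace (cm * S) with (2 ^ 2 * (cN * S * M)) by (unfold cm; ring). apply xsmooth_mult; auto. }
assert (Em : forall x y, 0 < x < alpha -> m (X x y) y = Vm x y).
{ intros x y Hx. eapply flux_along_flow; eauto. }
set (G := fun x y => Vm x y * / k (X x y) y).
assert (SG : xsmooth 2 (vstrip 0 alpha) K (cG * S) G).
{ replace (cG * S) with (2 ^ 2 * (cm * S * (C1 * Mik))) by (unfold cG; ring).
  apply xsmooth_mult; auto.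
  apply (HC1 _ _ U R0 Mik (fun x y => / k x y) X); auto. intros x y Hx; apply (HAs _ y); auto. }
set (W := fun x y => p x + RInt (G x) (L / 2) y).
assert (SW : xsmooth 2 (vstrip 0 alpha) K (cW * S) W).
{ replace (cW * S) with (S + r * (cG * S)) by (unfold cW; ring).
  apply xsmooth_plus; auto. apply xsmooth_RInt; auto. }
assert (EW : forall x y, 0 < x < alpha -> w (X x y) y = W x y).
{ intros x y Hx. unfold W.
  rewrite (solution_along_flow eps d L b h hx hy k kx ky Hst alpha X A Ha HX CX HA HXA HAs
    w wx wy wxx wxy wyy p Hw Hwx Hwy Hp x y Hx).
  f_equal. apply RInt_ext. intros s _. unfold G. rewrite <- Em; auto. }
assert (Cm := C1_flux _ _ _ _ _ _ _ _ _ _ Hst A HA HAs wx wy wxx wxy wyy Hwx Hwy).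
assert (HJ0 : forall x y, 0 < x < alpha -> J x y <> 0).
{ intros; apply Rgt_not_eq, jac_pos. }
assert (HXd' : forall x y, 0 < x < alpha -> is_derive (fun z => X z y) x (J x y)).
{ intros; apply HXd; lra. }
(* Each pullback costs one order: W, of order 2, yields wx at order 1 and then wxx at order 0; Vm
   yields m_x in the same way. *)
destruct (xsmooth_pullback_derivative 1 0 alpha K (cW * S) M w wx X J W) as (V1 & E1 & S1); auto.
{ intros x y Hx; apply Hw; auto. }
{ apply xsmooth_pred; auto. }
destruct (xsmooth_pullback_derivative 0 0 alpha K (2 ^ 1 * (cW * S * M)) M wx wxx X J V1) as (V2 & E2 & S2); auto.
{ intros x y Hx; apply Hwx; auto. }
{ do 2 apply xsmooth_pred; auto. }
destruct (xsmooth_pullback_derivative 1 0 alpha K (cm * S) M m mx X J Vm) as (V3 & E3 & S3); auto.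
{ intros x y Hx; apply Cm; auto. }
{ apply xsmooth_pred; auto. }
intros x0 y Hxy x.
assert (Hx0 := HK x0 y Hxy). assert (HR := HKR x0 y Hxy). fold x in HR.
assert (HAx := HXA x0 y Hx0). fold x in HAx.
assert (PcS : forall c', 0 <= c' -> 0 <= c' * S) by (intros; apply Rmult_le_pos; auto).
replace (second_order_const H * c * S) with (second_order_const H * (c * S)) by ring.
assert (EcS : c * S = S + cW * S + c1 * S + c2 * S + cm * S + c3 * S) by (unfold c; ring).
assert (T1 := PcS _ HcW). assert (T2 := PcS _ Hc1). assert (T3 := PcS _ Hc2).
assert (T4 := PcS _ Hcm). assert (T5 := PcS _ Hc3).
apply second_order_bounds with (h := h x y) (hx := hx x y) (hy := hy x y) (k := k x y)
  (kx := kx x y) (ky := ky x y) (g := g x y).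
- apply Rgt_not_eq, Hkpos, (HAs _ _ HAx).
- eapply Rle_trans; [eapply (xsmooth_bound _ _ _ _ (fun x y => / k x y)); eauto|unfold H; lra].
- eapply Rle_trans; [apply HB1; auto|unfold H; lra].
- eapply Rle_trans; [apply HB2; auto|unfold H; lra].
- eapply Rle_trans; [apply HB3; auto|unfold H; lra].
- eapply Rle_trans; [apply HB4; auto|unfold H; lra].
- eapply Rle_trans; [apply HB5; auto|unfold H; lra].
- apply Heq, HAx.
- assert (Rabs (g x y) <= S) by (eapply xsmooth_bound; [apply Hg|apply HKA; auto]). lra.
- assert (Rabs (w x y) <= cW * S) by (unfold x; rewrite EW by auto; eapply xsmooth_bound; eauto). lra.
- assert (Rabs (wx x y) <= c1 * S).
  { unfold x; rewrite E1 by auto. replace (c1 * S) with (2 ^ 1 * (cW * S * M)) by (unfold c1; ring).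
    eapply xsmooth_bound; eauto. } lra.
- assert (Rabs (wxx x y) <= c2 * S).
  { unfold x; rewrite E2 by auto.
    replace (c2 * S) with (2 ^ 0 * (2 ^ 1 * (cW * S * M) * M)) by (unfold c2, c1; ring).
    eapply xsmooth_bound; eauto. } lra.
- assert (Rabs (m x y) <= cm * S) by (unfold x; rewrite Em by auto; eapply xsmooth_bound; eauto).
  unfold m, flux in H0. lra.
- assert (Rabs (mx x y) <= c3 * S).
  { unfold x; rewrite E3 by auto. replace (c3 * S) with (2 ^ 1 * (cm * S * M)) by (unfold c3; ring).
    eapply xsmooth_bound; eauto. } unfold mx, flux_x in H0. lra.
Qed.

(** * The straightened coefficients *)

(** Over an empty set of bounds the constant is vacuous; resetting it to 0 lets regularity
    statements compose without bookkeeping. *)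
Lemma xsmooth_any_bound n U M M' f :
  xsmooth n U (fun _ _ => False) M f -> xsmooth n U (fun _ _ => False) M' f.
Proof.
revert f; induction n; simpl; intros f (Hc & _ & H); repeat split; auto; try tauto.
destruct H as (f' & Hd & H); exists f'; auto.
Qed.

Lemma ex_diff_n_C1 (A : R -> R -> Prop) n f : (forall x y, A x y -> ex_diff_n f (S n) x y) ->
  C1_on A f (dx f) (dy f) /\
  (forall x y, A x y -> ex_diff_n (dx f) n x y) /\ (forall x y, A x y -> ex_diff_n (dy f) n x y).
Proof.
intros H. split; [|split]; intros x y Hxy; destruct (H x y Hxy) as (_ & H1 & H2 & H3 & H4); auto.
split; [|split; [|split]].
- now apply Derive_correct.
- now apply Derive_correct.
- destruct n; apply H3.
- destruct n; apply H4.
Qed.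

Lemma ex_diff_n_xsmooth (A : R -> R -> Prop) n f : (forall x y, A x y -> ex_diff_n f n x y) ->
  xsmooth n A (fun _ _ => False) 0 f.
Proof.
revert f; induction n; intros f H; (split; [|split]); try tauto.
- intros; apply H; auto.
- intros; apply H; auto.
- exists (dx f). destruct (ex_diff_n_C1 A n f H) as (H1 & H2 & _). split; auto.
  intros; apply H1; auto.
Qed.

Lemma open2_locally_x A x y : open2 A -> A x y -> locally x (fun z => A z y).
Proof.
intros HA Hxy. destruct (HA x y Hxy) as [e He]. exists e. intros z Hz.
apply He; auto. rewrite Rminus_diag, Rabs_R0; apply cond_pos.
Qed.

Lemma open2_locally_y A x y : open2 A -> A x y -> locally y (A x).
Proof.
intros HA Hxy. destruct (HA x y Hxy) as [e He]. exists e. intros z Hz.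
apply He; auto. rewrite Rminus_diag, Rabs_R0; apply cond_pos.
Qed.

(** Schwarz's theorem on the open set A lets the single mixed derivative [dx (dy u)] serve in both
    places. *)
Lemma C2_derivatives A u : open2 A -> Cn_plane 2 A u ->
  C1_on A u (dx u) (dy u) /\ C1_on A (dx u) (dx (dx u)) (dx (dy u)) /\
  C1_on A (dy u) (dx (dy u)) (dy (dy u)).
Proof.
intros HA Hu. destruct (ex_diff_n_C1 A 1 u Hu) as (H1 & H2 & H3).
destruct (ex_diff_n_C1 A 0 (dx u) H2) as (H4 & _ & _).
destruct (ex_diff_n_C1 A 0 (dy u) H3) as (H5 & _ & _).
split; [|split]; auto.
assert (E : forall x y, A x y -> dy (dx u) x y = dx (dy u) x y).
{ intros x y Hxy. symmetry. refine (Schwarz u x y _ _ _).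
  - destruct (HA x y Hxy) as [e He]. exists e. intros a b Ha Hb.
    assert (Hab := He a b Ha Hb).
    destruct (H1 a b Hab) as (D1 & D2 & _). destruct (H5 a b Hab) as (D3 & _).
    destruct (H4 a b Hab) as (_ & D4 & _).
    split; [|split; [|split]]; [exists (dx u a b)|exists (dy u a b)|exists (dx (dy u) a b)|exists (dy (dx u) a b)];
      assumption.
  - apply H5; auto.
  - apply H4; auto. }
intros x y Hxy. destruct (H4 x y Hxy) as (F1 & F2 & F3 & F4). rewrite (E x y Hxy) in F2.
split; [|split; [|split]]; auto. apply H5; auto.
Qed.

(** The derivatives hidden in [xsmooth] must agree with [Derive_n] on the open set A, so bounds read
    off from the norms transfer to them. *)
Lemma xsmooth_with_bound n (A A' : R -> R -> Prop) M N g : open2 A -> (forall x y, A' x y -> A x y) ->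
  xsmooth n A (fun _ _ => False) M g ->
  (forall j x y, (j <= n)%nat -> A' x y -> Rabs (Derive_n (fun z => g z y) j x) <= N) ->
  xsmooth n A A' N g.
Proof.
intros HA HAA; revert g; induction n; intros g (Hc & _ & Hg) HB; (split; [|split]); auto.
- intros x y Hxy. apply (HB 0%nat x y); auto.
- intros x y Hxy. apply (HB 0%nat x y); auto; lia.
- destruct Hg as (g' & Hd & Hg). exists g'; split; auto.
  apply IHn; auto. intros j x y Hj Hxy.
  replace (Derive_n (fun z => g' z y) j x) with (Derive_n (fun z => g z y) (S j) x).
  + apply HB; auto; lia.
  + replace (S j) with (j + 1)%nat by lia. rewrite <- Derive_n_comp.
    apply Derive_n_ext_loc. generalize (open2_locally_x A x y HA (HAA _ _ Hxy)).
    apply filter_imp; intros z Hz. apply is_derive_unique, Hd, Hz.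
Qed.

(** Data on the base line are lifted to functions constant in y, so that one calculus covers f, P
    and Q. *)
Lemma line_xsmooth n a b (f : R -> R) : Cn_line n (fun x => a < x < b) f ->
  xsmooth n (vstrip a b) (fun _ _ => False) 0 (fun x _ => f x).
Proof.
revert f; induction n; intros f Hf; (split; [|split]); try tauto.
1, 2: intros x y Hx; apply (continuity_1d_2d_pt_comp f (fun u _ => u));
  [apply continuity_pt_filterlim; apply (Hf 0%nat x); auto; lia|apply continuity_2d_pt_id1].
exists (fun x _ => Derive f x); split.
- intros x y Hx. apply Derive_correct. apply (Hf 1%nat x); auto; lia.
- apply IHn. intros j x Hj Hx.
  assert (E : forall i, Derive_n (Derive f) i = Derive_n f (S i)).
  { intros i; apply functional_extensionality; intros z.
    replace (S i) with (i + 1)%nat by lia. rewrite <- Derive_n_comp. reflexivity. }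
  destruct (Hf (S j) x) as [F1 F2]; auto; [lia|]. split.
  + destruct j; [exact I|]. simpl. rewrite E. apply F1.
  + rewrite E. apply F2.
Qed.

(** The standing conditions give the sign of B_x above and below y = L/2; this supplies its value 0
    on that line, hence h = 0 and k = 1 there. *)
Lemma continuous_sign_change (f : R -> R) c : continuous f c ->
  (forall y, y < c -> 0 < f y) -> (forall y, c < y -> f y < 0) -> f c = 0.
Proof.
intros Hc H1 H2. apply continuity_pt_filterlim in Hc.
destruct (Rtotal_order (f c) 0) as [H|[H|H]]; auto; exfalso.
- destruct (Hc (- f c)) as (e & He & HE); [lra|]. simpl in HE; unfold R_dist in HE.
  assert (H3 := H1 (c - e / 2) ltac:(lra)).
  assert (H4 : Rabs (f (c - e / 2) - f c) < - f c).
  { apply HE. split; [split; [exact I|lra]|]. rewrite Rabs_left1; lra. }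
  apply Rabs_def2 in H4; lra.
- destruct (Hc (f c)) as (e & He & HE); [lra|]. simpl in HE; unfold R_dist in HE.
  assert (H3 := H2 (c + e / 2) ltac:(lra)).
  assert (H4 : Rabs (f (c + e / 2) - f c) < f c).
  { apply HE. split; [split; [exact I|lra]|]. rewrite Rabs_pos_eq; lra. }
  apply Rabs_def2 in H4; lra.
Qed.

(** The normalization cancels in h = F/G, and k = G^2/(F^2 + G^2) is rational in B, so the square
    root is never differentiated. As B is C^3, h_x retains two x-derivatives. *)
Lemma standing_straightened eps d L B b :
  Cn_plane 3 (fun _ _ => True) (xcomp B) -> Cn_plane 3 (fun _ _ => True) (ycomp B) ->
  standing eps d L B -> is_normalization eps d L B b ->
  exists h hx hy k kx ky, straightened eps d L b h hx hy k kx ky.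
Proof.
intros CF CG HB Hb. destruct HB as [He Hd HL _ Hbelow Habove _ _ HG _ Hwall _].
set (F := xcomp B) in *. set (G := ycomp B) in *.
set (U := vstrip (- eps) (d / 2)). assert (HU : open2 U) by apply vstrip_open.
assert (GP : forall x y, U x y -> 0 < G x y) by (intros; apply HG; auto).
destruct (ex_diff_n_C1 U 2 F) as (F1 & F2 & _); [intros; apply CF; auto|].
destruct (ex_diff_n_C1 U 2 G) as (G1 & G2 & _); [intros; apply CG; auto|].
assert (SF : xsmooth 2 U (fun _ _ => False) 0 F).
{ apply xsmooth_pred, ex_diff_n_xsmooth. intros; apply CF; auto. }
assert (SG : xsmooth 2 U (fun _ _ => False) 0 G).
{ apply xsmooth_pred, ex_diff_n_xsmooth. intros; apply CG; auto. }
apply ex_diff_n_xsmooth in F2. apply ex_diff_n_xsmooth in G2.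
assert (Hinv : forall f, xsmooth 2 U (fun _ _ => False) 0 f -> (forall x y, U x y -> f x y <> 0) ->
  xsmooth 2 U (fun _ _ => False) 0 (fun x y => / f x y)).
{ intros f Hf Hf0. destruct (xsmooth_inv 2 0 0) as [M HM].
  apply xsmooth_any_bound with M, HM; auto. tauto. }
assert (Hmul : forall f g, xsmooth 2 U (fun _ _ => False) 0 f -> xsmooth 2 U (fun _ _ => False) 0 g ->
  xsmooth 2 U (fun _ _ => False) 0 (fun x y => f x y * g x y)).
{ intros f g Hf Hg. eapply xsmooth_any_bound, xsmooth_mult; eauto. }
assert (Hadd : forall f g, xsmooth 2 U (fun _ _ => False) 0 f -> xsmooth 2 U (fun _ _ => False) 0 g ->
  xsmooth 2 U (fun _ _ => False) 0 (fun x y => f x y + g x y)).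
{ intros f g Hf Hg. eapply xsmooth_any_bound, xsmooth_plus; eauto. }
assert (GN : forall x y, U x y -> G x y <> 0) by (intros x y H; apply Rgt_not_eq, GP, H).
assert (NP : forall x y, U x y -> 0 < F x y * F x y + G x y * G x y).
{ intros x y H; specialize (GP x y H); nra. }
assert (NN : forall x y, U x y -> F x y * F x y + G x y * G x y <> 0).
{ intros x y H; apply Rgt_not_eq, NP, H. }
assert (H1 := C1_mult _ _ _ _ _ _ _ HU F1 (C1_inv _ _ _ _ HU G1 GN)).
assert (HFF := C1_mult _ _ _ _ _ _ _ HU F1 F1).
assert (HGG := C1_mult _ _ _ _ _ _ _ HU G1 G1).
assert (H2 := C1_mult _ _ _ _ _ _ _ HU HGG
  (C1_inv _ _ _ _ HU (C1_plus _ _ _ _ _ _ _ HFF HGG) NN)).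
(* The six functions are determined by unification with [H1] and [H2], whose types display h, k and
   their computed partials. *)
do 6 eexists. split; [exact He|exact Hd| | |exact H1|exact H2| | | | |].
- apply (Hadd (fun x y => dx F x y * / G x y)
    (fun x y => F x y * - (dx G x y * (/ G x y * / G x y)))); auto.
  apply (Hmul F (fun x y => - (dx G x y * (/ G x y * / G x y)))); auto.
  apply xsmooth_opp, Hmul; auto.
- apply (Hmul (fun x y => G x y * G x y) (fun x y => / (F x y * F x y + G x y * G x y))); auto.
- intros x y Hx. assert (GPx := GP x y Hx).
  assert (NPx : 0 < F x y ^ 2 + G x y ^ 2) by (generalize (NP x y Hx); simpl; lra).
  set (n := sqrt (F x y ^ 2 + G x y ^ 2)).
  assert (Hn : 0 < n) by (apply sqrt_lt_R0; auto).
  assert (Hn2 : n * n = F x y ^ 2 + G x y ^ 2) by (apply sqrt_sqrt; lra).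
  assert (Eb : b (x, y) = (F x y / n, G x y / n)).
  { apply (Hb (x, y)). split; [unfold strip; simpl; lra|]. intros E; inversion E; lra. }
  assert (E1 : xcomp b x y = F x y / n) by (unfold xcomp at 1; rewrite Eb; reflexivity).
  assert (E2 : ycomp b x y = G x y / n) by (unfold ycomp at 1; rewrite Eb; reflexivity).
  rewrite E1, E2. clearbody n.
  split; [field; split; lra|]. split; [split|].
  + apply Rdiv_lt_0_compat; auto.
  + apply Rmult_le_reg_r with n; auto. unfold Rdiv; rewrite Rmult_assoc, Rinv_l by lra.
    rewrite Rmult_1_r, Rmult_1_l. apply Rsqr_incr_0; unfold Rsqr; nra.
  + replace ((G x y / n) ^ 2) with (G x y * G x y * / (n * n)) by (field; lra).
    rewrite Hn2. f_equal. f_equal. simpl; ring.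
- intros x Hx. assert (Hxd : 0 < x < d) by lra.
  assert (HUx : U x (L / 2)) by (unfold U, vstrip; lra).
  assert (E : F x (L / 2) = 0).
  { apply continuous_sign_change; auto.
    apply (continuity_2d_pt_section_y F x (L / 2)). apply CF; auto. }
  cbv beta; rewrite E. split; [ring|]. specialize (GP _ _ HUx). field. lra.
- intros y. destruct (Hwall y) as [E _]. cbv beta; rewrite E; ring.
- intros x y Hx Hy. apply Rmult_lt_0_compat; [apply Hbelow; lra|].
  apply Rinv_0_lt_compat, GP; unfold U, vstrip; lra.
- intros x y Hx Hy. assert (0 < / G x y) by (apply Rinv_0_lt_compat, GP; unfold U, vstrip; lra).
  assert (F x y < 0) by (apply Habove; lra). nra.
Qed.

(** The identities b_x = h b_y and b_y^2 = k turn the components of (b ⊗ b)∇u into h m and m. They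
    are known near points of A only, so the derivatives are transferred by local equality. *)
Lemma Delta_par_flux eps d L b h hx hy k kx ky A u x y :
  straightened eps d L b h hx hy k kx ky -> open2 A ->
  (forall x y, A x y -> - eps < x < d / 2) -> Cn_plane 2 A u -> A x y ->
  Delta_par b u x y = hx x y * flux h k (dx u) (dy u) x y
   + h x y * flux_x h hx k kx (dx u) (dy u) (dx (dx u)) (dx (dy u)) x y
   + flux_y h hy k ky (dx u) (dy u) (dx (dy u)) (dy (dy u)) x y.
Proof.
intros Hst HA HAs Hu Hxy. destruct (C2_derivatives A u HA Hu) as (_ & Hux & Huy).
assert (Hh : C1_on A h hx hy) by (eapply C1_sub; [apply HAs|apply Hst]).
assert (Hm := C1_flux _ _ _ _ _ _ _ _ _ _ Hst A HA HAs _ _ _ _ _ Hux Huy).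
assert (Hhm := C1_mult _ _ _ _ _ _ _ HA Hh Hm).
unfold Delta_par. f_equal.
- unfold dx at 1.
  rewrite (Derive_ext_loc _ (fun z => h z y * flux h k (dx u) (dy u) z y)).
  + apply is_derive_unique. apply (Hhm x y Hxy).
  + generalize (open2_locally_x A x y HA Hxy); apply filter_imp; intros z Hz.
    destruct (st_b Hst z y (HAs _ _ Hz)) as (-> & _ & E).
    unfold flux. rewrite <- E. ring.
- unfold dy at 1.
  rewrite (Derive_ext_loc _ (fun z => flux h k (dx u) (dy u) x z)).
  + apply is_derive_unique. apply (Hm x y Hxy).
  + generalize (open2_locally_y A x y HA Hxy); apply filter_imp; intros z Hz.
    destruct (st_b Hst x z (HAs _ _ Hz)) as (-> & _ & E).
    unfold flux. rewrite <- E. ring.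
Qed.

(** * The estimate *)

(** A point of U is essential: the supremum over an empty set would be minus infinity. *)
Lemma norm_plane_nonneg n (U : R -> R -> Prop) f x y : U x y -> Rbar_le 0 (norm_plane n U f).
Proof.
intros H. apply Rbar_le_trans with (Finite (Rabs (partial_derive 0 0 f x y))).
- apply Rabs_pos.
- apply Lub_Rbar_correct. exists 0%nat, 0%nat, x, y. repeat split; auto; lia.
Qed.

Lemma norm_line_nonneg n (U : R -> Prop) f x : U x -> Rbar_le 0 (norm_line n U f).
Proof.
intros H. apply Rbar_le_trans with (Finite (Rabs (Derive_n f 0 x))).
- apply Rabs_pos.
- apply Lub_Rbar_correct. exists 0%nat, x. repeat split; auto; lia.
Qed.

Lemma norm_plane_ub n (U : R -> R -> Prop) f N j k x y : norm_plane n U f = Finite N ->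
  (j + k <= n)%nat -> U x y -> Rabs (partial_derive j k f x y) <= N.
Proof.
intros HN Hj H. change (Rbar_le (Rabs (partial_derive j k f x y)) N). rewrite <- HN.
apply Lub_Rbar_correct. exists j, k, x, y. auto.
Qed.

Lemma norm_line_ub n (U : R -> Prop) f N j x : norm_line n U f = Finite N ->
  (j <= n)%nat -> U x -> Rabs (Derive_n f j x) <= N.
Proof.
intros HN Hj H. change (Rbar_le (Rabs (Derive_n f j x)) N). rewrite <- HN.
apply Lub_Rbar_correct. exists j, x. auto.
Qed.

(** [partial_derive] differentiates in y before x, so the mixed partial it produces is the
    x-derivative of [wy]. *)
Lemma C2_norm_plane_le (A U : R -> R -> Prop) w wx wy wxx wxy wyy M : open2 A ->
  (forall x y, U x y -> A x y) ->
  C1_on A w wx wy -> C1_on A wx wxx wxy -> C1_on A wy wxy wyy ->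
  (forall x y, U x y -> Rabs (w x y) <= M /\ Rabs (wx x y) <= M /\ Rabs (wy x y) <= M /\
    Rabs (wxx x y) <= M /\ Rabs (wxy x y) <= M /\ Rabs (wyy x y) <= M) ->
  Rbar_le (norm_plane 2 U w) M.
Proof.
intros HA HUA H0 H1 H2 HB. apply Lub_Rbar_correct.
intros r (j & k & x & y & Hjk & HU & ->). simpl.
destruct (HB x y HU) as (B & Bx & By & Bxx & Bxy & Byy).
assert (HAx := HUA x y HU).
assert (Ex : forall x y, A x y -> Derive (fun z => w z y) x = wx x y)
  by (intros; apply is_derive_unique, H0; auto).
assert (Ey : forall x y, A x y -> Derive (w x) y = wy x y)
  by (intros; apply is_derive_unique, H0; auto).
destruct j as [|[|[|j]]]; destruct k as [|[|[|k]]]; try lia; unfold partial_derive; simpl.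
- auto.
- change (fun x0 => w x x0) with (w x). rewrite Ey; auto.
- rewrite (Derive_ext_loc _ (wy x)).
  + rewrite (is_derive_unique _ _ (wyy x y)); auto. apply H2, HAx.
  + generalize (open2_locally_y A x y HA HAx); apply filter_imp; intros z Hz; apply (Ey x z Hz).
- rewrite Ex; auto.
- rewrite (Derive_ext_loc _ (fun z => wy z y)).
  + rewrite (is_derive_unique _ _ (wxy x y)); auto. apply H2, HAx.
  + generalize (open2_locally_x A x y HA HAx); apply filter_imp; intros z Hz; apply (Ey z y Hz).
- rewrite (Derive_ext_loc _ (fun z => wx z y)).
  + rewrite (is_derive_unique _ _ (wxx x y)); auto. apply H1, HAx.
  + generalize (open2_locally_x A x y HA HAx); apply filter_imp; intros z Hz; apply (Ex z y Hz).
Qed.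

(** * The domains in the coordinates (x0, y) *)

Section Domain.
Variables (eps d L : R) (b : R * R -> R * R) (h hx hy k kx ky : R -> R -> R)
  (Phi : R -> R * R -> R * R) (alpha : R).
Hypothesis Hst : straightened eps d L b h hx hy k kx ky.
Hypothesis HPhi : is_flow eps d L b Phi.
Hypothesis Ha : 0 < alpha < d / 2.

Lemma xflow_scalar_flow : scalar_flow (d / 2) (L / 2) h (xflow L Phi).
Proof.
intros x Hx. split; [eapply xflow_start; eauto|]. intros y. split.
- eapply xflow_range; eauto.
- eapply is_derive_xflow; eauto.
Qed.

(** The trajectory from alpha reaches every height and stays at abscissae at most alpha < d/2, so
    the domain is the full region between the wall and the curve. *)
Lemma Dalpha_iff x y : Dalpha d L Phi alpha x y <-> 0 < x < xflow L Phi alpha y.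
Proof.
split.
- intros (_ & t & <- & Ht). unfold xflow.
  rewrite (crossing_time_snd_flow _ _ _ _ _ _ _ _ _ _ _ Hst HPhi alpha Ha). exact Ht.
- intros H. assert (HR := xflow_range _ _ _ _ _ _ _ _ _ _ _ Hst HPhi alpha Ha y).
  split; [lra|]. exists (crossing_time L Phi alpha y). split; [|exact H].
  apply (snd_flow_crossing_time _ _ _ _ _ _ _ _ _ _ _ Hst HPhi alpha Ha).
Qed.

Lemma Dalpha_open : open2 (Dalpha d L Phi alpha).
Proof.
intros x y Hxy. apply Dalpha_iff in Hxy.
destruct (xflow_scalar_flow alpha Ha) as [_ HX]. destruct (HX y) as [_ D].
apply is_derive_continuity_pt in D.
(* The midpoint separates x from the bounding curve, and both sides of the separation persist
   nearby. *)
set (mu := (x + xflow L Phi alpha y) / 2).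
destruct (D (xflow L Phi alpha y - mu)) as (e1 & He1 & H1); [unfold mu; lra|].
simpl in H1; unfold R_dist in H1.
destruct (locally_open_interval 0 mu x) as [e2 H2]; [unfold mu; lra|].
assert (He : 0 < Rmin e1 e2) by (apply Rmin_pos; auto; apply cond_pos).
exists (mkposreal _ He); simpl; intros u v Hu Hv.
assert (Rmin e1 e2 <= e1) by apply Rmin_l. assert (E2 : Rmin e1 e2 <= e2) by apply Rmin_r.
assert (Hu' : 0 < u < mu) by (apply H2; apply Rlt_le_trans with (2 := E2); auto).
apply Dalpha_iff. split; [lra|].
destruct (Req_dec v y) as [->|Hne]; [unfold mu in *; lra|].
assert (Hd : Rabs (xflow L Phi alpha v - xflow L Phi alpha y) < xflow L Phi alpha y - mu).
{ apply H1. split; [split; auto; exact I|lra]. }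
apply Rabs_def2 in Hd; lra.
Qed.

Lemma xflow_increasing x1 x2 y : 0 < x1 -> x1 < x2 -> x2 < d / 2 ->
  xflow L Phi x1 y < xflow L Phi x2 y.
Proof.
intros H1 H12 H2.
(* Taken with r = 0 and an empty K, for the formula dX/dx0 = J alone; monotonicity then follows from
   J > 0. *)
destruct (scalar_flow_xsmooth eps (d / 2) (L / 2) 0 h hx hy x2) as (M & _ & HM).
- apply Hst.
- lra.
- apply Hst.
- apply Hst.
- destruct (HM (xflow L Phi) (fun _ _ => False) xflow_scalar_flow) as (HD & _); try tauto.
  { intros ? ? []. }
  destruct (MVT_derive (fun z => xflow L Phi z y) (fun z => jac (L / 2) hx (xflow L Phi) z y) x1 x2)
    as (r & E & _); auto.
  + intros z Hz; apply HD; lra.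
  + assert (HJ := jac_pos (L / 2) hx (xflow L Phi) r y). nra.
Qed.

Lemma xflow_in_Dalpha x y : 0 < x < alpha -> Dalpha d L Phi alpha (xflow L Phi x y) y.
Proof.
intros Hx. apply Dalpha_iff. split.
- apply (xflow_range _ _ _ _ _ _ _ _ _ _ _ Hst HPhi x); lra.
- apply xflow_increasing; lra.
Qed.

(** The preimage of [Ddelta] in the coordinates (x0, y). Its time window is not a fixed window of
    heights, since the height reached in a given time depends on x0; a larger box would leave the
    region where f - f0 is controlled. *)
Definition flow_box (delta x y : R) : Prop :=
  delta < x < alpha - delta /\ - / delta < crossing_time L Phi x y < / delta.

Variable delta : R.
Hypothesis Hd : 0 < delta < alpha / 2.

(** Crossing times are monotone in the height and vanish at L/2, so heights between L/2 and y are
    crossed within the same time window. *)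
Lemma flow_box_vstar : vstar (L / 2) (/ delta) (flow_box delta).
Proof.
intros x y [Hx Ht]. assert (Hx' : 0 < x < d / 2) by lra.
split.
- eapply Rle_trans; [eapply crossing_time_bound; eauto|]. apply Rabs_le; lra.
- intros s Hs. split; auto.
  assert (T0 := crossing_time_start _ _ _ _ _ _ _ _ _ _ _ Hst HPhi x Hx').
  assert (HT := crossing_time_le _ _ _ _ _ _ _ _ _ _ _ Hst HPhi x Hx').
  revert Hs; unfold Rmin, Rmax; destruct (Rle_dec (L / 2) y); intros [S1 S2];
  apply HT in S1, S2; rewrite T0 in *; lra.
Qed.

Lemma flow_box_Ddelta x y : flow_box delta x y -> Ddelta L Phi alpha delta (xflow L Phi x y) y.
Proof.
intros [Hx Ht]. assert (Hx' : 0 < x < d / 2) by lra.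
exists x, (crossing_time L Phi x y). split; [auto|split; [auto|]].
rewrite (surjective_pairing (flow_map L Phi x (crossing_time L Phi x y))).
now rewrite (snd_flow_crossing_time _ _ _ _ _ _ _ _ _ _ _ Hst HPhi x Hx').
Qed.

Lemma Ddelta_flow_box x y : Ddelta L Phi alpha delta x y ->
  exists x0, flow_box delta x0 y /\ x = xflow L Phi x0 y.
Proof.
intros (x0 & t & Hx & Ht & E). assert (Hx' : 0 < x0 < d / 2) by lra.
assert (Et := crossing_time_snd_flow _ _ _ _ _ _ _ _ _ _ _ Hst HPhi x0 Hx' t).
cbv beta zeta in Et; rewrite E in Et; simpl in Et. exists x0. split.
- split; auto. now rewrite Et.
- unfold xflow. now rewrite Et, E.
Qed.

Lemma Ddelta_nonempty : Ddelta L Phi alpha delta (alpha / 2) (L / 2).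
Proof.
assert (Hi : 0 < / delta) by (apply Rinv_0_lt_compat; lra).
assert (Hx' : 0 < alpha / 2 < d / 2) by lra.
exists (alpha / 2), 0. split; [lra|split; [lra|]].
destruct (flow_start _ _ _ _ _ _ _ _ _ _ _ Hst HPhi (alpha / 2) Hx') as [E1 E2].
rewrite (surjective_pairing (flow_map L Phi (alpha / 2) 0)). now rewrite E1, E2.
Qed.

Lemma Ddelta_Dalpha x y : Ddelta L Phi alpha delta x y -> Dalpha d L Phi alpha x y.
Proof.
intros H. destruct (Ddelta_flow_box x y H) as (x0 & [Hx _] & ->).
apply xflow_in_Dalpha; lra.
Qed.

End Domain.

Lemma Cn_plane_minus_xsmooth n A f f0 : Cn_plane n A f -> Cn_plane n A f0 ->
  xsmooth n A (fun _ _ => False) 0 (fun x y => f x y - f0 x y).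
Proof.
intros H H0. eapply xsmooth_any_bound.
apply (xsmooth_plus n A _ 0 0 f (fun x y => - f0 x y)).
- apply ex_diff_n_xsmooth, H.
- apply xsmooth_opp, ex_diff_n_xsmooth, H0.
Qed.

Lemma Cn_line_minus_xsmooth n a c f f0 : Cn_line n (fun x => a < x < c) f ->
  Cn_line n (fun x => a < x < c) f0 ->
  xsmooth n (vstrip a c) (fun _ _ => False) 0 (fun x _ => f x - f0 x).
Proof.
intros H H0. eapply xsmooth_any_bound.
apply (xsmooth_plus n (vstrip a c) _ 0 0 (fun x _ => f x) (fun x _ => - f0 x)).
- apply line_xsmooth, H.
- apply (xsmooth_opp n (vstrip a c) _ 0 (fun x _ => f0 x)), line_xsmooth, H0.
Qed.

Lemma Rbar_mult_pos_p_infty C : 0 < C -> Rbar_mult C p_infty = p_infty.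
Proof.
intros H. apply is_Rbar_mult_unique, is_Rbar_mult_sym, is_Rbar_mult_p_infty_pos. exact H.
Qed.

Lemma Rbar_le_p_infty x : Rbar_le x p_infty.
Proof. destruct x; exact I. Qed.

(* The domain of b determines eps, d and L, so C, quantified before B, depends
   only on alpha, delta and b. *)
Theorem corollary1 :
  forall (eps d L : R) (b : R * R -> R * R) (alpha delta : R),
  0 < alpha < d / 2 ->
  0 < delta < alpha / 2 ->
  exists C : R,
  forall (B : R * R -> R * R) (Phi : R -> R * R -> R * R),
  Cn_plane 3 (fun _ _ => True) (xcomp B) ->
  Cn_plane 3 (fun _ _ => True) (ycomp B) ->
  standing eps d L B ->
  is_normalization eps d L B b ->
  is_flow eps d L b Phi ->
  forall (f f0 : R -> R -> R) (P P0 Q Q0 : R -> R) (u u0 : R -> R -> R),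
  Cn_plane 2 (Dalpha d L Phi alpha) f ->
  Cn_plane 2 (Dalpha d L Phi alpha) f0 ->
  Cn_line 2 (fun x => 0 < x < alpha) P ->
  Cn_line 2 (fun x => 0 < x < alpha) P0 ->
  Cn_line 2 (fun x => 0 < x < alpha) Q ->
  Cn_line 2 (fun x => 0 < x < alpha) Q0 ->
  is_solution d L b Phi alpha f P Q u ->
  is_solution d L b Phi alpha f0 P0 Q0 u0 ->
  Rbar_le
    (norm_plane 2 (Ddelta L Phi alpha delta) (fun x y => u x y - u0 x y))
    (Rbar_mult C
      (Rbar_plus
        (Rbar_plus
          (norm_plane 2 (Ddelta L Phi alpha delta) (fun x y => f x y - f0 x y))
          (norm_line 2 (fun x => delta < x < alpha - delta) (fun x => P x - P0 x)))
        (norm_line 2 (fun x => delta < x < alpha - delta) (fun x => Q x - Q0 x)))).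
Proof.
intros eps d L b alpha delta Ha Hd.
(* C may depend on b only: the straightened coefficients are chosen once, from
   whichever B realizes b. *)
destruct (classic (exists h hx hy k kx ky, straightened eps d L b h hx hy k kx ky))
  as [(h & hx & hy & k & kx & ky & Hst)|Hno].
2:{ exists 0. intros B Phi H1 H2 H3 H4. exfalso. apply Hno.
    eapply standing_straightened; eauto. }
assert (Hr : 0 <= / delta) by (left; apply Rinv_0_lt_compat; lra).
destruct (solution_estimate eps d L b h hx hy k kx ky alpha (/ delta) Hst Ha Hr)
  as (C & HC & HE).
exists C. intros B Phi _ _ _ _ HPhi f f0 P P0 Q Q0 u u0 Hf Hf0 HP HP0 HQ HQ0 Hu Hu0.
set (A := Dalpha d L Phi alpha) in *. set (A' := Ddelta L Phi alpha delta).
set (I := fun x => delta < x < alpha - delta).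
assert (HA : open2 A) by (eapply Dalpha_open; eauto).
assert (HAA : forall x y, A' x y -> A x y) by (eapply Ddelta_Dalpha; eauto).
assert (HAs : forall x y, A x y -> - eps < x < d / 2).
{ intros x y [Hx _]. generalize (st_eps Hst); lra. }
assert (NI : I (alpha / 2)) by (unfold I; lra).
assert (NA : A' (alpha / 2) (L / 2)) by (eapply Ddelta_nonempty; eauto).
assert (N1 := norm_plane_nonneg 2 A' (fun x y => f x y - f0 x y) _ _ NA).
assert (N2 := norm_line_nonneg 2 I (fun x => P x - P0 x) _ NI).
assert (N3 := norm_line_nonneg 2 I (fun x => Q x - Q0 x) _ NI).
(* The norms are nonnegative, so if one is infinite the sum is too, and multiplying by C > 0 keeps
   it infinite. Only the case of three finite norms remains. *)
destruct (norm_plane 2 A' (fun x y => f x y - f0 x y)) as [n1| |] eqn:E1; try (exfalso; exact N1);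
destruct (norm_line 2 I (fun x => P x - P0 x)) as [n2| |] eqn:E2; try (exfalso; exact N2);
destruct (norm_line 2 I (fun x => Q x - Q0 x)) as [n3| |] eqn:E3; try (exfalso; exact N3);
simpl Rbar_plus; try (rewrite Rbar_mult_pos_p_infty by auto; apply Rbar_le_p_infty).
simpl in N1, N2, N3.
set (S := n1 + n2 + n3).
change (Rbar_mult C (n1 + n2 + n3)) with (Finite (C * S)).
destruct (C2_derivatives A u HA (sol_C2 _ _ _ _ _ _ _ _ _ Hu)) as (U0 & U1 & U2).
destruct (C2_derivatives A u0 HA (sol_C2 _ _ _ _ _ _ _ _ _ Hu0)) as (V0 & V1 & V2).
assert (W0 := C1_minus _ _ _ _ _ _ _ U0 V0).
assert (W1 := C1_minus _ _ _ _ _ _ _ U1 V1).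
assert (W2 := C1_minus _ _ _ _ _ _ _ U2 V2).
assert (HKx : forall x y, flow_box L Phi alpha delta x y -> 0 < x < alpha).
{ intros x y [Hx _]; lra. }
eapply C2_norm_plane_le; [exact HA|exact HAA|exact W0|exact W1|exact W2|].
intros x y Hxy.
destruct (Ddelta_flow_box _ _ _ _ _ _ _ _ _ _ _ _ Hst HPhi Ha delta Hd x y Hxy) as (x0 & HK & ->).
apply (HE (xflow L Phi) (flow_box L Phi alpha delta) A A' S (fun x y => f x y - f0 x y)
  (fun x y => u x y - u0 x y)
  (fun x y => dx u x y - dx u0 x y) (fun x y => dy u x y - dy u0 x y)
  (fun x y => dx (dx u) x y - dx (dx u0) x y) (fun x y => dx (dy u) x y - dx (dy u0) x y)
  (fun x y => dy (dy u) x y - dy (dy u0) x y)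
  (fun x => P x - P0 x) (fun x => Q x - Q0 x)); auto.
- eapply xflow_scalar_flow; eauto.
- eapply flow_box_vstar; eauto.
- intros; eapply xflow_in_Dalpha; eauto.
- intros; eapply flow_box_Ddelta; eauto.
(* Linearity: for fixed coefficients the flux form is linear in the derivatives of the unknown, so
   the two equations subtract. *)
- intros a c Hac.
  assert (D1 := Delta_par_flux _ _ _ _ _ _ _ _ _ _ A u a c Hst HA HAs (sol_C2 _ _ _ _ _ _ _ _ _ Hu) Hac).
  assert (D2 := Delta_par_flux _ _ _ _ _ _ _ _ _ _ A u0 a c Hst HA HAs (sol_C2 _ _ _ _ _ _ _ _ _ Hu0) Hac).
  rewrite <- (sol_eq _ _ _ _ _ _ _ _ _ Hu a c Hac), <- (sol_eq _ _ _ _ _ _ _ _ _ Hu0 a c Hac), D1, D2.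
  unfold flux, flux_x, flux_y. ring.
- intros a Haa. rewrite (sol_P _ _ _ _ _ _ _ _ _ Hu a Haa), (sol_P _ _ _ _ _ _ _ _ _ Hu0 a Haa). reflexivity.
- intros a Haa. destruct (sol_Q _ _ _ _ _ _ _ _ _ Hu a Haa) as [_ ->].
  destruct (sol_Q _ _ _ _ _ _ _ _ _ Hu0 a Haa) as [_ ->]. reflexivity.
- unfold S; lra.
- apply xsmooth_with_bound with (M := 0); auto.
  + apply Cn_plane_minus_xsmooth; auto.
  (* The j-th x-derivative is the partial derivative of order (j, 0), hence bounded by the norm on
     D_alpha^delta. *)
  + intros j a c Hj Hac. apply Rle_trans with n1; [|unfold S; lra].
    apply (norm_plane_ub 2 A' _ n1 j 0 a c E1); auto; lia.
- apply xsmooth_with_bound with (M := 0); [apply vstrip_open|apply HKx|apply Cn_line_minus_xsmooth; auto|].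
  intros j a c Hj [Hac _]. apply Rle_trans with n2; [|unfold S; lra].
  apply (norm_line_ub 2 I (fun x => P x - P0 x)); auto.
- apply xsmooth_with_bound with (M := 0); [apply vstrip_open|apply HKx|apply Cn_line_minus_xsmooth; auto|].
  intros j a c Hj [Hac _]. apply Rle_trans with n3; [|unfold S; lra].
  apply (norm_line_ub 2 I (fun x => Q x - Q0 x)); auto.
Qed.
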